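(* Let $\{(G_n,\mathcal M(G_n))\}_{n\ge1}$ be finite (random) marked networks, $G_n$ having vertex set $[n]$, with empirical rooted laws $\mathcal P_n$. Assume: (B1) $\mathcal P_n\overset{\mathbb P}{\Rightarrow}\mathcal P$ for a deterministic rooted law $\mathcal P$; (B2) every finite-network response $f_i$ is bounded, nonnegative, nondecreasing and $1$-Lipschitz; and the same conditions hold $\mathcal P$-almost surely at every vertex of the limiting forward component; (B3) (root coalescence) on the limiting network, the iterates $x^{\pm,k}$ of the update started from $x_v^{-,0}=0$ and $x_v^{+,0}=\mathfrak b(f_v)$ satisfy $x_o^{+,k}-x_o^{-,k}\to0$ almost surely as $k\to\infty$. Then every finite system admits least and greatest equilibria, and the limiting extremal root iterates $x_o^{-,k}$ and $x_o^{+,k}$ have a common limit $x_o^\star$ as $k\to\infty$. For every measurable selection $x^\star(n)$ of a finite-network equilibrium and every bounded Lipschitz $\varphi:\mathbb R\to\mathbb R$, $$\frac1n\sum_{i=1}^n\varphi\bigl(x_i^\star(n)\bigr)\xrightarrow{\mathbb P}\mathbb E[\varphi(x_o^\star)].$$ In particular, $x_{o_n}^\star(n)\Rightarrow x_o^\star$ (convergence in distribution).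
   Context: **Marks.** $\mathcal T$ is a Polish space (of types) with a complete compatible metric. $\mathsf F_{\mathrm{ne}}$ is the set of bounded, nonnegative, nondecreasing, $1$-Lipschitz $f:\mathbb R\to\mathbb R$ with metric $\|f-g\|_\infty$, and $\mathfrak b(f):=\sup_zf(z)$ (no common bound on $\mathfrak b(f)$ is imposed). The vertex-mark space is $\mathsf M^V=\mathcal T\times\mathbb R\times\mathsf F_{\mathrm{ne}}$ with a complete product metric $d_{\mathsf M^V}$; a vertex $v$ has mark $m_v=(\tau_v,\epsilon_v,f_v)$ (type, shock, response). The edge-mark space is $\mathsf M^E=(0,\infty)$ with $d_{\mathsf M^E}(c,c')=|\log c-\log c'|$; an edge $(v,u)$ has mark $C_{vu}>0$ (exposure). **Rooted marked graphs and local topology.** A directed graph $G=(V,E)$ is forward locally finite if every vertex has finite out-degree (in-degrees are unrestricted). A rooted marked directed graph $(G,o,\mathcal M(G))$ is such a graph with a root $o\in V$ and marks $m_v\in\mathsf M^V$, $m_e\in\mathsf M^E$. An isomorphism is a vertex bijection preserving edges in both directions, the root, and all marks; $\mathcal G_*$ is the set of isomorphism classes. Let $d_G^+(o,v)$ be the length of a shortest directed path from $o$ to $v$ ($\infty$ if none), $V_k^+(o)=\{v:d_G^+(o,v)\le k\}$ and $E_k^+(o)=\{(v,u)\in E:d_G^+(o,v)<k\}$. For $\xi=[G,o,\mathcal M(G)]$, $[\xi]_k$ is the isomorphism class of the rooted marked graph with vertex set $V_k^+(o)$, edge set $E_k^+(o)$ and the original marks; $\mathfrak X_k$ is the set of such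 classes. Put $d_V=1\wedge d_{\mathsf M^V}$, $d_E=1\wedge d_{\mathsf M^E}$. For $a,b\in\mathfrak X_r$ let $d_r(a,b)=1$ if there is no root-preserving isomorphism of the underlying directed graphs (ignoring marks), and otherwise $d_r(a,b)=\min_\phi\max\{\max_v d_V(m_v,m'_{\phi(v)}),\max_{(v,u)}d_E(m_{(v,u)},m'_{(\phi(v),\phi(u))})\}$ over such isomorphisms $\phi$ (an empty maximum is $0$). Set $d_{\mathrm{loc}}(\xi,\xi')=\sum_{r\ge0}2^{-r-1}d_r([\xi]_r,[\xi']_r)$, and let $\widetilde{\mathcal G}_*$ be the quotient of $\mathcal G_*$ by $\{d_{\mathrm{loc}}=0\}$, a Polish space with metric $d_{\mathrm{loc}}$. **Empirical rooted laws.** $\mathcal P_n=\frac1n\sum_{i=1}^n\delta_{[G_n,i,\mathcal M(G_n)]}$, a random probability measure on $\widetilde{\mathcal G}_*$. For a deterministic law $\mathcal P$, $\mathcal P_n\overset{\mathbb P}{\Rightarrow}\mathcal P$ means $\int h\,d\mathcal P_n\to\int h\,d\mathcal P$ in probability for every bounded continuous $h:\widetilde{\mathcal G}_*\to\mathbb R$. **Weights, update, equilibria.** For an edge, $W_{vu}=C_{vu}/\sum_{w:(v,w)\in E}C_{vw}$; absent edges have weight $0$, so vertices without outgoing edges have zero network input. On $G_n$ write $W_{ij}(n),\tau_i(n),\epsilon_i(n),f_i$. An equilibrium of the finite network is a vector with $x_i=f_i\bigl(\sum_jW_{ij}(n)x_j+\epsilon_i(n)\bigr)$ for all $i\in[n]$;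 least and greatest refer to the coordinatewise order. A measurable selection is a random vector that is an equilibrium of the realized network (extra randomness may be used in the selection). **Limit.** $(G,o,\mathcal M(G))$ denotes a random rooted network with law $\mathcal P$, where $G$ is taken to be the root's forward component, $V(G)=\bigcup_{r\ge0}V_r^+(o)$. The iterates are $x_v^{\pm,k+1}=f_v\bigl(\sum_{u:(v,u)\in E(G)}W_{vu}x_u^{\pm,k}+\epsilon_v\bigr)$, $v\in V(G)$, $k\ge0$. **Sampling.** $o_n$ is uniform on $[n]$ conditionally on the marked network and any randomness used to select its equilibrium. *)

(* Defs.v *)
From HB Require Import structures.
From mathcomp Require Import all_boot all_order all_algebra.
From mathcomp Require Import all_classical all_reals all_analysis.
From mathcomp Require Import lra.

Set Implicit Arguments.
Unset Strict Implicit.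
Unset Printing Implicit Defensive.

Import Order.TTheory GRing.Theory Num.Theory.
Import numFieldNormedType.Exports.

Local Open Scope classical_set_scope.
Local Open Scope ring_scope.
Local Open Scope quotient_scope.

Definition admissible (R : realType) (f : R -> R) : Prop :=
  [/\ bounded_fun f, forall z, 0 <= f z, {homo f : x y / x <= y}
    & 1.-lipschitz f].

Record response (R : realType) := Response {
  resp_fun :> R -> R;
  resp_admissible : admissible resp_fun }.

Section response_metric.
Context {R : realType}.
Implicit Types f g h : response R.

HB.instance Definition _ := gen_eqMixin (response R).
HB.instance Definition _ := gen_choiceMixin (response R).

Lemma admissible0 : admissible (fun _ : R => 0 : R).
Proof.
split => //.
- by exists 0; split => // x x0 y _ /=; rewrite normr0 ltW.
- by move=> [x y] _ /=; rewrite subrr normr0 mul1r.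
Qed.

HB.instance Definition _ := isPointed.Build (response R) (Response admissible0).

Definition resp_sup f : R := sup (range f).

Definition resp_dist f g : R := sup (range (fun z => `|f z - g z|)).

Lemma resp_bounded f : exists M, forall z, `|f z| <= M.
Proof.
have [[M [_ +]] _ _ _] := resp_admissible f.
move=> /(_ (M + 1)); rewrite ltrDl ltr01 => /(_ isT) fM.
by exists (M + 1) => z; exact: fM.
Qed.

Lemma resp_dist_has_sup f g : has_sup (range (fun z => `|f z - g z|)).
Proof.
have [M fM] := resp_bounded f; have [N gN] := resp_bounded g.
split; first by exists (`|f 0 - g 0|), 0.
by exists (M + N) => _ [z _ <-]; rewrite (le_trans (ler_normB _ _))// lerD.
Qed.

Lemma resp_dist_ub f g z : `|f z - g z| <= resp_dist f g.
Proof. by apply: (sup_upper_bound (resp_dist_has_sup f g)); exists z. Qed.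

Lemma resp_dist_le f g c : (forall z, `|f z - g z| <= c) -> resp_dist f g <= c.
Proof.
move=> fgc; apply: ge_sup; first by exists (`|f 0 - g 0|), 0.
by move=> _ [z _ <-].
Qed.

Lemma resp_ext f g : f =1 g -> f = g.
Proof.
case: f g => [f hf] [g hg] /= /funext fg; subst g.
by congr Response; exact: Prop_irrelevance.
Qed.

Lemma resp_distxx f : resp_dist f f = 0.
Proof.
apply/le_anti; rewrite resp_dist_le/=; last by move=> z; rewrite subrr normr0.
by rewrite (le_trans _ (resp_dist_ub f f 0)).
Qed.

Lemma resp_dist_pos f g : resp_dist f g = 0 -> f = g.
Proof.
move=> fg0; apply: resp_ext => z; apply/eqP.
by rewrite -subr_eq0 -normr_le0 -fg0 resp_dist_ub.
Qed.

Lemma resp_dist_sym f g : resp_dist f g = resp_dist g f.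
Proof.
by apply/le_anti/andP; split; apply: resp_dist_le => z; rewrite distrC resp_dist_ub.
Qed.

Lemma resp_dist_triangle g f h :
  resp_dist f h <= resp_dist f g + resp_dist g h.
Proof.
apply: resp_dist_le => z.
by rewrite (le_trans (ler_distD (g z) _ _))// lerD// resp_dist_ub.
Qed.

HB.instance Definition _ := isMetric.Build R (response R)
  resp_distxx resp_dist_pos resp_dist_sym resp_dist_triangle.

End response_metric.

(* Type, shock and response of a vertex, with the product topology. *)
Notation vertex_mark R T := (T * R * response R)%type.

(* Any complete metric inducing the product topology on vertex marks. *)
Record mark_metric (R : realType) (T : completePseudoMetricType R) :=
  MarkMetric {
    mark_dist :> vertex_mark R T -> vertex_mark R T -> R;
    mark_distxx : forall m, mark_dist m m = 0;
    mark_dist_pos : forall m m', mark_dist m m' = 0 -> m = m';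
    mark_dist_sym : forall m m', mark_dist m m' = mark_dist m' m;
    mark_dist_triangle : forall m2 m1 m3,
      mark_dist m1 m3 <= mark_dist m1 m2 + mark_dist m2 m3;
    mark_dist_nbhs : forall (m : vertex_mark R T) (A : set (vertex_mark R T)),
      nbhs m A <-> exists2 e, 0 < e & [set m' | mark_dist m m' < e] `<=` A;
    mark_dist_complete : forall u : nat -> vertex_mark R T,
      (forall e, 0 < e -> exists N, forall i j, (N <= i)%N -> (N <= j)%N ->
        mark_dist (u i) (u j) < e) ->
      exists m : vertex_mark R T, u @ \oo --> m }.

(* [emark v u] is the exposure of the edge (v, u); its value is irrelevant,
   and never used, when (v, u) is not an edge. Loops are allowed. *)
Record network (R : realType) (T : completePseudoMetricType R) (V : Type) :=
  Network {
    edge : rel V;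
    edge_finite : forall v, finite_set [set u | edge v u];
    vmark : V -> vertex_mark R T;
    emark : V -> V -> {posnum R} }.

Record rooted_network (R : realType) (T : completePseudoMetricType R) :=
  RootedNetwork {
    vtx : Type;
    root : vtx;
    net :> network T vtx }.

Section network_theory.
Context {R : realType} {T : completePseudoMetricType R} {V : choiceType}.
Variable N : network T V.
Implicit Types (v u : V) (x : V -> R).

Definition shock v : R := (vmark N v).1.2.

Definition resp v : response R := (vmark N v).2.

Definition weight v u : R :=
  if edge N v u then
    (emark N v u)%:num / \sum_(w \in [set w | edge N v w]) (emark N v w)%:num
  else 0.

Definition update x v : R :=
  resp v (\sum_(u \in [set u | edge N v u]) weight v u * x u + shock v).

End network_theory.

Section finite_network.
Context {R : realType} {T : completePseudoMetricType R} {n : nat}.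
Variable N : network T 'I_n.
Implicit Types x y : 'I_n -> R.

Definition equilibrium x : Prop :=
  forall i, x i = resp N i (\sum_j weight N i j * x j + shock N i).

Definition least_equilibrium x : Prop :=
  equilibrium x /\ forall y, equilibrium y -> forall i, x i <= y i.

Definition greatest_equilibrium x : Prop :=
  equilibrium x /\ forall y, equilibrium y -> forall i, y i <= x i.

End finite_network.

Section rooted.
Context {R : realType} {T : completePseudoMetricType R}.
Implicit Types N a b c : rooted_network T.

(* [{classic _}] only provides the choice structure needed by finite sums. *)
Definition root_iterate N (x0 : vtx N -> R) (k : nat) : R :=
  iter k (@update R T {classic vtx N} N) x0 (root N).

Definition lower_iterate N (k : nat) : R :=
  @root_iterate N (fun=> 0) k.

Definition upper_iterate N (k : nat) : R :=
  @root_iterate N (fun v => resp_sup (@resp R T {classic vtx N} N v)) k.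

(* [p] lists the vertices, root excluded, of a directed walk from the root to
   [v], so that its length is [size p]. *)
Definition walk N (p : seq (vtx N)) (v : vtx N) : Prop :=
  path (edge N) (root N) p /\ last (root N) p = v.

Definition forward_connected N : Prop := forall v, exists p, @walk N p v.

(* [reach_within N k v] means d^+(root, v) <= k. *)
Definition reach_within N (k : nat) (v : vtx N) : Prop :=
  exists2 p, walk p v & (size p <= k)%N.

Lemma reach_within_root N k : reach_within k (root N).
Proof. by exists [::]. Qed.

Definition trunc_vtx N (k : nat) : Type := {v : vtx N | reach_within k v}.

(* An edge (v, u) is kept when d^+(root, v) < k. *)
Definition trunc_edge N k : rel (trunc_vtx N k) := fun v u =>
  edge N (sval v) (sval u) &&
  `[< exists2 p, walk p (sval v) & (size p < k)%N >].

Lemma trunc_edge_finite N k (v : trunc_vtx N k) :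
  finite_set [set u | trunc_edge v u].
Proof.
apply: (@sub_finite_set _ _
  ((@sval _ _ : {classic (trunc_vtx N k)} -> {classic (vtx N)})
     @^-1` [set u | edge N (sval v) u])).
  by move=> u /= /andP[].
apply: finite_preimage; last exact: edge_finite.
move=> [x hx] [y hy] _ _ /= xy; subst y.
by congr exist; exact: Prop_irrelevance.
Qed.

Definition trunc N (k : nat) : rooted_network T :=
  @RootedNetwork R T (trunc_vtx N k) (exist _ (root N) (reach_within_root N k))
    (@Network R T (trunc_vtx N k) (@trunc_edge N k) (@trunc_edge_finite N k)
       (fun v => vmark N (sval v)) (fun v u => emark N (sval v) (sval u))).

(* Isomorphisms of the underlying rooted directed graphs, ignoring marks. *)
Definition graph_isos a b : set (vtx a -> vtx b) :=
  [set phi | [/\ bijective phi, phi (root a) = root b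
    & forall v u, edge b (phi v) (phi u) = edge a v u]].

End rooted.

Arguments graph_isos {R T} a b.

Section local_metric.
Context {R : realType} {T : completePseudoMetricType R}.
Variable D : mark_metric T.
Implicit Types a b c : rooted_network T.

Definition dV (m m' : vertex_mark R T) : R := Num.min 1 (D m m').

Definition dE (c c' : {posnum R}) : R :=
  Num.min 1 `|ln (c%:num : R) - ln (c'%:num : R)|.

Definition iso_cost a b (phi : vtx a -> vtx b) : R :=
  Num.max
    (sup [set dV (vmark a v) (vmark b (phi v)) | v in setT])
    (sup [set dE (emark a e.1 e.2) (emark b (phi e.1) (phi e.2))
         | e in [set e | edge a e.1 e.2]]).

(* On truncations the sets involved are finite, so that [sup] and [inf] are a
   maximum ([sup set0 = 0]) and a minimum. *)
Definition dtrunc a b : R :=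
  if `[< graph_isos a b !=set0 >] then inf (@iso_cost a b @` graph_isos a b)
  else 1.

Definition dloc_term a b (r : nat) : R :=
  2^-1 ^+ r.+1 * dtrunc (trunc a r) (trunc b r).

Definition dloc a b : R := limn (series (dloc_term a b)).

Lemma dV_itv m m' : 0 <= dV m m' <= 1.
Proof.
rewrite /dV le_min ler01 ge_min lexx /= andbT.
have := mark_dist_triangle D m' m m.
by rewrite mark_distxx (mark_dist_sym D m' m) -mulr2n pmulrn_lge0.
Qed.

Lemma dE_itv (c c' : {posnum R}) : 0 <= dE c c' <= 1.
Proof. by rewrite /dE le_min ler01 ge_min lexx /= andbT. Qed.

Lemma min1_triangle (x y z : R) : 0 <= x -> 0 <= y -> z <= x + y ->
  Num.min 1 z <= Num.min 1 x + Num.min 1 y.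
Proof. by move=> x0 y0 zxy; rewrite /Num.min; do !case: ifPn; lra. Qed.

Lemma dV_triangle m2 m1 m3 : dV m1 m3 <= dV m1 m2 + dV m2 m3.
Proof.
have D0 m m' : 0 <= D m m'.
  by have := dV_itv m m'; rewrite /dV le_min => /andP[/andP[]].
exact: min1_triangle (mark_dist_triangle D m2 m1 m3).
Qed.

Lemma dE_triangle (c2 c1 c3 : {posnum R}) : dE c1 c3 <= dE c1 c2 + dE c2 c3.
Proof. by apply: min1_triangle => //; exact: ler_distD. Qed.

Lemma sup_le_itv (A : set R) (x : R) : 0 <= x -> (forall y, A y -> y <= x) ->
  sup A <= x.
Proof.
move=> x0 Ax; have [->|/set0P A0] := eqVneq A set0; first by rewrite sup0.
exact: ge_sup.
Qed.

Lemma iso_cost_le a b (phi : vtx a -> vtx b) (x : R) : 0 <= x ->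
  (forall v, dV (vmark a v) (vmark b (phi v)) <= x) ->
  (forall v u, edge a v u -> dE (emark a v u) (emark b (phi v) (phi u)) <= x) ->
  iso_cost phi <= x.
Proof.
move=> c0 Vc Ec; rewrite /iso_cost ge_max; apply/andP; split.
  by apply: sup_le_itv => // _ [v _ <-].
by apply: sup_le_itv => // _ [[v u] /= vu <-]; exact: Ec.
Qed.

Lemma iso_cost_V a b (phi : vtx a -> vtx b) v :
  dV (vmark a v) (vmark b (phi v)) <= iso_cost phi.
Proof.
rewrite /iso_cost le_max; apply/orP; left; apply: ub_le_sup; last by exists v.
by exists 1 => _ [w _ <-]; have /andP[] := dV_itv (vmark a w) (vmark b (phi w)).
Qed.

Lemma iso_cost_E a b (phi : vtx a -> vtx b) v u : edge a v u ->
  dE (emark a v u) (emark b (phi v) (phi u)) <= iso_cost phi.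
Proof.
move=> vu; rewrite /iso_cost le_max; apply/orP; right.
apply: ub_le_sup; last by exists (v, u).
exists 1 => _ [[w z] _ <-] /=.
by have /andP[] := dE_itv (emark a w z) (emark b (phi w) (phi z)).
Qed.

Lemma iso_cost_ge0 a b (phi : vtx a -> vtx b) : 0 <= iso_cost phi.
Proof.
apply: le_trans (iso_cost_V phi (root a)).
by have /andP[] := dV_itv (vmark a (root a)) (vmark b (phi (root a))).
Qed.

Lemma iso_cost_le1 a b (phi : vtx a -> vtx b) : iso_cost phi <= 1.
Proof.
apply: iso_cost_le => // [v|v u _].
  by have /andP[] := dV_itv (vmark a v) (vmark b (phi v)).
by have /andP[] := dE_itv (emark a v u) (emark b (phi v) (phi u)).
Qed.

Lemma iso_cost_has_inf a b : graph_isos a b !=set0 ->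
  has_inf (@iso_cost a b @` graph_isos a b).
Proof.
move=> [phi iphi]; split; first by exists (iso_cost phi), phi.
by exists 0 => _ [psi _ <-]; exact: iso_cost_ge0.
Qed.

Lemma dtrunc_le a b phi : graph_isos a b phi -> dtrunc a b <= iso_cost phi.
Proof.
move=> iphi; rewrite /dtrunc; case: asboolP => [ab|]; last by case; exists phi.
by apply: (inf_lbound (proj2 (iso_cost_has_inf ab))); exists phi.
Qed.

Lemma dtrunc_ge0 a b : 0 <= dtrunc a b.
Proof.
rewrite /dtrunc; case: asboolP => // -[phi iphi].
apply: lb_le_inf; first by exists (iso_cost phi), phi.
by move=> _ [psi _ <-]; exact: iso_cost_ge0.
Qed.

Lemma dtrunc_le1 a b : dtrunc a b <= 1.
Proof.
have [[phi iphi]|nab] := pselect (graph_isos a b !=set0).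
  exact: le_trans (dtrunc_le iphi) (iso_cost_le1 _).
by rewrite /dtrunc; case: asboolP.
Qed.

Lemma dtruncxx a : dtrunc a a = 0.
Proof.
apply/le_anti; rewrite dtrunc_ge0 andbT.
have iid : graph_isos a a id by split => //; exists id.
apply: le_trans (dtrunc_le iid) _; apply: iso_cost_le => // [v|v u _].
  by rewrite /dV mark_distxx ge_min lexx orbT.
by rewrite /dE subrr normr0 ge_min lexx orbT.
Qed.

Lemma dtrunc_adherent a b (e : R) : graph_isos a b !=set0 -> 0 < e ->
  exists2 phi, graph_isos a b phi & iso_cost phi < dtrunc a b + e.
Proof.
move=> ab e0; have [_ [phi iphi <-]] := inf_adherent e0 (iso_cost_has_inf ab).
by move=> ?; exists phi => //; rewrite /dtrunc asboolT.
Qed.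

Lemma graph_isos_inv a b phi : graph_isos a b phi ->
  exists psi, [/\ graph_isos b a psi, cancel phi psi & cancel psi phi].
Proof.
move=> [[psi phiK psiK] phir phie]; exists psi; split => //; split.
- by exists phi.
- by rewrite -phir phiK.
- by move=> v u; rewrite -phie !psiK.
Qed.

Lemma iso_cost_inv a b (phi : vtx a -> vtx b) psi : graph_isos a b phi ->
  cancel psi phi -> iso_cost psi <= iso_cost phi.
Proof.
move=> [_ _ phie] psiK; apply: iso_cost_le; first exact: iso_cost_ge0.
  move=> v; rewrite {1}/dV mark_dist_sym -{2}(psiK v); exact: iso_cost_V.
move=> v u vu; rewrite {1}/dE distrC -{2}(psiK v) -{2}(psiK u).
by apply: iso_cost_E; rewrite -phie !psiK.
Qed.

Lemma dtrunc_sym_le a b : dtrunc a b <= dtrunc b a.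
Proof.
have [ba|nba] := pselect (graph_isos b a !=set0); last first.
  by rewrite {2}/dtrunc asboolF// dtrunc_le1.
apply/ler_addgt0Pr => e e0; have [phi iphi phie] := dtrunc_adherent ba e0.
have [psi [ipsi phiK psiK]] := graph_isos_inv iphi.
apply: le_trans (dtrunc_le ipsi) _; apply: le_trans (ltW phie).
exact: iso_cost_inv.
Qed.

Lemma dtrunc_triangle b a c : dtrunc a c <= dtrunc a b + dtrunc b c.
Proof.
have [ab|nab] := pselect (graph_isos a b !=set0); last first.
  rewrite {2}/dtrunc asboolF// (le_trans (dtrunc_le1 a c))// lerDl.
  exact: dtrunc_ge0.
have [bc|nbc] := pselect (graph_isos b c !=set0); last first.
  rewrite {3}/dtrunc asboolF// (le_trans (dtrunc_le1 a c))// lerDr.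
  exact: dtrunc_ge0.
apply/ler_addgt0Pr => e e0; have e20 : 0 < e / 2 by rewrite divr_gt0.
have [phi iphi phie] := dtrunc_adherent ab e20.
have [psi ipsi psie] := dtrunc_adherent bc e20.
have icomp : graph_isos a c (psi \o phi).
  case: iphi ipsi => [bphi phir phiE] [bpsi psir psiE]; split => /=.
  - exact: bij_comp.
  - by rewrite phir psir.
  - by move=> v u; rewrite psiE phiE.
have : iso_cost (psi \o phi) <= iso_cost phi + iso_cost psi.
  apply: iso_cost_le; first by rewrite addr_ge0// iso_cost_ge0.
    move=> v; apply: le_trans (dV_triangle (vmark b (phi v)) _ _) _.
    by rewrite lerD// iso_cost_V.
  move=> v u vu; apply: le_trans (dE_triangle (emark b (phi v) (phi u)) _ _) _.
  rewrite lerD ?iso_cost_E//; case: iphi => _ _ ->//.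
by have := dtrunc_le icomp; lra.
Qed.

Lemma dloc_term_itv a b r : 0 <= dloc_term a b r <= 2^-1 ^+ r.+1.
Proof.
have p0 : 0 <= 2^-1 ^+ r.+1 :> R by rewrite exprn_ge0// invr_ge0.
by rewrite mulr_ge0 ?dtrunc_ge0//= ler_piMr// dtrunc_le1.
Qed.

Lemma is_cvg_dloc a b : cvgn (series (dloc_term a b)).
Proof.
apply: (@series_le_cvg _ _ (geometric 2^-1 2^-1)).
- by move=> r; have /andP[] := dloc_term_itv a b r.
- by move=> r; rewrite /geometric/= mulr_ge0 ?exprn_ge0 ?invr_ge0.
- move=> r; rewrite /geometric/= -exprS.
  by have /andP[] := dloc_term_itv a b r.
- by apply: is_cvg_geometric_series; rewrite ger0_norm ?invr_ge0// invf_lt1// ltr1n.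
Qed.

Lemma dloc_ge0 a b : 0 <= dloc a b.
Proof.
apply: limr_ge; first exact: is_cvg_dloc.
apply: nearW => n; apply: sumr_ge0 => r _.
by have /andP[] := dloc_term_itv a b r.
Qed.

Lemma dlocxx a : dloc a a = 0.
Proof.
rewrite /dloc (_ : series _ = cst 0) ?lim_cst//.
by apply/funext => n; apply: big1 => r _; rewrite /dloc_term dtruncxx mulr0.
Qed.

Lemma dloc_sym a b : dloc a b = dloc b a.
Proof.
rewrite /dloc; congr (limn (series _)); apply/funext => r.
by rewrite /dloc_term; congr (_ * _); apply/le_anti; rewrite !dtrunc_sym_le.
Qed.

Lemma dloc_triangle b a c : dloc a c <= dloc a b + dloc b c.
Proof.
have ab := @is_cvg_dloc a b; have bc := @is_cvg_dloc b c.
rewrite /dloc -limD//; apply: ler_lim.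
- exact: is_cvg_dloc.
- exact: is_cvgD.
- apply: nearW => n; rewrite /series/= fctE -big_split/=; apply: ler_sum => r _.
  by rewrite /dloc_term -mulrDr ler_wpM2l ?dtrunc_triangle//.
Qed.

HB.instance Definition _ := gen_eqMixin (rooted_network T).
HB.instance Definition _ := gen_choiceMixin (rooted_network T).

Definition dloc_eq a b : bool := dloc a b == 0.

Lemma dloc_eq_refl : reflexive dloc_eq.
Proof. by move=> a; rewrite /dloc_eq dlocxx. Qed.

Lemma dloc_eq_sym : symmetric dloc_eq.
Proof. by move=> a b; rewrite /dloc_eq dloc_sym. Qed.

Lemma dloc_eq_trans : transitive dloc_eq.
Proof.
move=> b a c; rewrite /dloc_eq => /eqP ab /eqP bc.
by rewrite eq_le dloc_ge0 andbT (le_trans (dloc_triangle b a c))// ab bc addr0.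
Qed.

Canonical dloc_equiv := EquivRel dloc_eq dloc_eq_refl dloc_eq_sym dloc_eq_trans.

End local_metric.

(* The quotient of all rooted networks by {d_loc = 0}. As isomorphic networks
   are at distance 0 (lemma [dloc_network_iso] below), first passing to
   isomorphism classes would yield the same space. *)
Section rooted_space.
Context {R : realType} {T : completePseudoMetricType R}.
Variable D : mark_metric T.

Definition rooted_space : Type := {eq_quot (dloc_equiv D)}.

HB.instance Definition _ := EqQuotient.on rooted_space.
HB.instance Definition _ := Choice.on rooted_space.

Definition rooted_class (a : rooted_network T) : rooted_space :=
  \pi_rooted_space a.

Definition rooted_dist (x y : rooted_space) : R := dloc D (repr x) (repr y).

Lemma rooted_distxx x : rooted_dist x x = 0.
Proof. exact: dlocxx. Qed.

Lemma rooted_dist_pos x y : rooted_dist x y = 0 -> x = y.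
Proof.
by move=> xy0; rewrite -[x]reprK -[y]reprK; apply/eqquotP/eqP.
Qed.

Lemma rooted_dist_sym x y : rooted_dist x y = rooted_dist y x.
Proof. exact: dloc_sym. Qed.

Lemma rooted_dist_triangle y x z :
  rooted_dist x z <= rooted_dist x y + rooted_dist y z.
Proof. exact: dloc_triangle. Qed.

Lemma rooted_dist_class a b :
  rooted_dist (rooted_class a) (rooted_class b) = dloc D a b.
Proof.
have rK c : dloc D (repr (rooted_class c)) c = 0.
  have /eqP : repr (rooted_class c) = c %[mod rooted_space] by rewrite reprK.
  by rewrite eqquotE => /eqP.
have rK' c : dloc D c (repr (rooted_class c)) = 0 by rewrite dloc_sym.
apply/le_anti/andP; split.
  apply: le_trans (dloc_triangle D a _ _) _; rewrite rK add0r.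
  by apply: le_trans (dloc_triangle D b _ _) _; rewrite rK' addr0.
apply: le_trans (dloc_triangle D (repr (rooted_class a)) _ _) _.
rewrite rK' add0r.
apply: le_trans (dloc_triangle D (repr (rooted_class b)) _ _) _.
by rewrite rK addr0.
Qed.

HB.instance Definition _ := isMetric.Build R rooted_space
  rooted_distxx rooted_dist_pos rooted_dist_sym rooted_dist_triangle.

Lemma finite_set_edge0 (v : unit) : finite_set [set u : unit | false].
Proof. by apply: (sub_finite_set _ (finite_set0 unit)) => u. Qed.

HB.instance Definition _ := isPointed.Build rooted_space
  (rooted_class (@RootedNetwork R T unit tt
    (@Network R T unit (fun _ _ => false) finite_set_edge0
      (fun=> (point, 0, point)) (fun _ _ => 1%:pos)))).

(* [rooted_space] with its Borel sigma-algebra. *)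
Definition rooted_borel := g_sigma_algebraType (@open rooted_space).

HB.instance Definition _ := Measurable.on rooted_borel.

End rooted_space.

Section network_iso.
Context {R : realType} {T : completePseudoMetricType R}.
Implicit Types a b : rooted_network T.

Definition network_iso a b (phi : vtx a -> vtx b) : Prop :=
  [/\ graph_isos a b phi, forall v, vmark b (phi v) = vmark a v
    & forall v u, edge a v u -> emark b (phi v) (phi u) = emark a v u].

Lemma walk_iso a b phi p v : graph_isos a b phi ->
  walk p v -> walk (map phi p) (phi v).
Proof.
move=> [_ phir phie] [pp pv]; split; last by rewrite -phir last_map pv.
by rewrite -phir path_map; apply: sub_path pp => x y /=; rewrite phie.
Qed.

Lemma dloc_network_iso (D : mark_metric T) a b phi :
  @network_iso a b phi -> dloc D a b = 0.
Proof.
move=> [iphi phiV phiE]; have [psi [ipsi phiK psiK]] := graph_isos_inv iphi.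
have walkE p v : walk p v <-> walk (map phi p) (phi v).
  split; first exact: walk_iso.
  by move/(walk_iso ipsi); rewrite phiK (mapK phiK).
have withinE k v : reach_within k v <-> reach_within k (phi v).
  split=> -[p pv pk].
    by exists (map phi p); rewrite ?size_map//; apply/walkE.
  by exists (map psi p); rewrite ?size_map// -(phiK v); exact: walk_iso.
rewrite /dloc (_ : series _ = cst 0) ?lim_cst//.
apply/funext => n; apply: big1 => k _; rewrite /dloc_term.
suff -> : dtrunc D (trunc a k) (trunc b k) = 0 by rewrite mulr0.
pose f (v : trunc_vtx a k) : trunc_vtx b k :=
  exist _ (phi (sval v)) (proj1 (withinE k (sval v)) (svalP v)).
have wg (v : trunc_vtx b k) : reach_within k (psi (sval v)).
  by apply/withinE; rewrite psiK; exact: svalP.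
pose g (v : trunc_vtx b k) : trunc_vtx a k := exist _ (psi (sval v)) (wg v).
have sval_inj' c (v u : trunc_vtx c k) : sval v = sval u -> v = u.
  case: v u => [v hv] [u hu] /= vu; subst u; congr exist.
  exact: Prop_irrelevance.
have isof : graph_isos (trunc a k) (trunc b k) f.
  case: (iphi) => _ phir phie; split.
  - exists g => v; apply: sval_inj'; [exact: phiK|exact: psiK].
  - exact: sval_inj'.
  - move=> v u; rewrite /= /trunc_edge /= phie; congr (_ && _).
    apply: asbool_equiv_eq; split=> -[p pv pk].
      exists (map psi p); rewrite ?size_map//.
      by rewrite -(phiK (sval v)); exact: walk_iso.
    by exists (map phi p); rewrite ?size_map//; exact/walkE.
apply/le_anti; rewrite dtrunc_ge0 andbT.
apply: le_trans (dtrunc_le D isof) _; apply: iso_cost_le => // [v|v u].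
  by rewrite /= phiV /dV mark_distxx ge_min lexx orbT.
by move=> /andP[vu _] /=; rewrite phiE// /dE subrr normr0 ge_min lexx orbT.
Qed.

End network_iso.

(* 'I_n does not fit in the universe of [vtx] (the type of rooted networks is
   itself used as a carrier of [set]); [rooted_at N o] is an isomorphic copy of
   (N, o) on a small type. *)
Section rooted_at.
Context {R : realType} {T : completePseudoMetricType R} {n : nat}.
Variables (N : network T 'I_n) (o : 'I_n).

Definition ord_vtx : Type := {i : nat | (i < n)%N}.

Definition vtx_ord (v : ord_vtx) : 'I_n := Ordinal (svalP v).

Definition ord_edge : rel ord_vtx := fun v u => edge N (vtx_ord v) (vtx_ord u).

Lemma ord_edge_finite v : finite_set [set u | ord_edge v u].
Proof.
apply: (@finite_preimage {classic ord_vtx} 'I_n [set u | edge N (vtx_ord v) u]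
  vtx_ord); last exact: edge_finite.
move=> [x hx] [y hy] _ _ [xy]; subst y.
by congr exist; exact: Prop_irrelevance.
Qed.

Definition rooted_at : rooted_network T :=
  @RootedNetwork R T ord_vtx (exist _ (val o) (ltn_ord o))
    (@Network R T ord_vtx ord_edge ord_edge_finite
       (fun v => vmark N (vtx_ord v))
       (fun v u => emark N (vtx_ord v) (vtx_ord u))).

End rooted_at.

Section empirical_law.
Context {R : realType} {T : completePseudoMetricType R}.
Variable D : mark_metric T.

Definition empirical_law n (N : network T 'I_n.+1) :
    {measure set (rooted_borel D) -> \bar R} :=
  mscale (n.+1%:R^-1)%:nng
    (msum (fun i => \d_(rooted_class D (rooted_at N (inord i)) :
                        rooted_borel D)) n.+1).

End empirical_law.

Section randomness.
Context {R : realType} {T : completePseudoMetricType R}.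

(* Measurability with respect to the sigma-algebra [F] of a random network with
   a fixed vertex set; exposures only matter where the edge is present. *)
Definition random_network (Om : Type) (F : set (set Om)) (V : Type)
    (N : Om -> network T V) : Prop :=
  (forall v (B : set (vertex_mark R T)), <<s open >> B ->
     F [set w | B (vmark (N w) v)]) /\
  (forall v u (B : set R), measurable B ->
     F [set w | edge (N w) v u /\ B (emark (N w) v u)%:num]).

Definition cvg_in_prob (d : nat -> measure_display)
    (Om : forall n, measurableType (d n)) (Pr : forall n, probability (Om n) R)
    (X : forall n, Om n -> R) (c : R) : Prop :=
  forall e, 0 < e ->
    (fun n => Pr n [set w | e < `|X n w - c|]) @ \oo --> 0%E.

Definition cvg_in_distribution (d : nat -> measure_display)
    (Om : forall n, measurableType (d n)) (Pr : forall n, probability (Om n) R)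
    (X : forall n, Om n -> R) (d' : measure_display) (Om' : measurableType d')
    (Q : probability Om' R) (Y : Om' -> R) : Prop :=
  forall psi : R -> R, continuous psi -> bounded_fun psi ->
    (fun n => 'E_(Pr n)[psi \o X n])%E @ \oo --> ('E_Q[psi \o Y])%E.

(* [o] is uniform on the vertices conditionally on the sigma-algebra [F]. *)
Definition uniform_given (d : measure_display) (Om : measurableType d)
    (Pr : probability Om R) (F : set (set Om)) (n : nat) (o : Om -> 'I_n.+1) :
    Prop :=
  (forall i, measurable [set w | o w = i]) /\
  (forall i A, F A -> Pr (A `&` [set w | o w = i]) = Pr A * (n.+1%:R^-1)%:E)%E.

End randomness.

(* Main.v *)
From HB Require Import structures.
From mathcomp Require Import all_boot all_order all_algebra.
From mathcomp Require Import all_classical all_reals all_analysis.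
From mathcomp Require Import measurable_realfun lra.
Require Import Defs.

(** Equilibria are fixed points of the update map, which is monotone because the
weights are nonnegative and the responses nondecreasing; its values at a vertex
lie between zero and the supremum of the response. Knaster-Tarski gives the
least and greatest equilibria, and monotonicity squeezes every equilibrium, at
every order [k], between the iterates of order [k] started from zero and from
the suprema of the responses ([equilibrium_between]).

The point of the squeeze is that the iterates of order [k] are local. After [k]
updates the value at the root depends only on the marks within distance [k]
([iterate_trunc]), and it is a continuous function of these marks; hence it is a
continuous function on the space of rooted networks
([class_iterate_continuous]). Continuity is not uniform: the estimates at a
network involve the out-degrees and the marks of that network. Convergence of
the empirical laws then applies to bounded continuous functions of the iterates
of a fixed order.

Let [phi] be bounded by [M] and [K]-Lipschitz. The average of [phi] over an
equilibrium differs from its average over the lower iterate of order [k] by at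
most the average of [min (2 * M) (K * gap)], where the gap is the difference of
the upper and lower iterates. Both averages converge in probability to the
corresponding expectations on the limit as the size of the network grows. On the
limit, the lower iterate of the root is nondecreasing in [k] and bounded, which
defines the common limit of the iterates, and the gap vanishes almost surely by
root coalescence; bounded convergence in [k] concludes
([equilibrium_average_cvg]).

Sampling a uniform vertex turns the expectation of a test function at this
vertex into the expectation of the average ([integral_uniform_vertex]), which
converges since the averages are bounded and converge in probability. This
handles Lipschitz test functions, and these determine convergence in
distribution ([cvg_in_distribution_lipschitz]).

Convergence in probability speaks of measurable events only, so the iterates of
the random finite networks have to be shown measurable; the delicate step is the
evaluation of a random response at a random point ([measurable_resp_eval]). *)

Set Implicit Arguments.
Unset Strict Implicit.
Unset Printing Implicit Defensive.

Import Order.TTheory GRing.Theory Num.Theory.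
Import numFieldNormedType.Exports.

Local Open Scope classical_set_scope.
Local Open Scope ring_scope.
Local Open Scope quotient_scope.

(** * The update map *)

Section update_theory.
Context {R : realType} {T : completePseudoMetricType R} {V : choiceType}.
Variable N : network T V.
Implicit Types (v u : V) (x y : V -> R).

Lemma weight_ge0 v u : 0 <= weight N v u.
Proof.
rewrite /weight; case: ifP => // _; apply: divr_ge0 => //.
by apply: fsumr_ge0.
Qed.

Lemma resp_ge0 v z : 0 <= resp N v z.
Proof. by case: (resp_admissible (resp N v)). Qed.

Lemma resp_nd v : {homo resp N v : y z / y <= z}.
Proof. by case: (resp_admissible (resp N v)). Qed.

Lemma le_resp_sup (f : response R) z : f z <= resp_sup f.
Proof.
have [M fM] := resp_bounded f; apply: ub_le_sup; last by exists z.
by exists M => _ [t _ <-]; rewrite (le_trans (ler_norm _)).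
Qed.

Lemma resp_sup_ge0 (f : response R) : 0 <= resp_sup f.
Proof. by case: (resp_admissible f) => _ f0 _ _; exact: le_trans (le_resp_sup f 0). Qed.

Lemma update_ge0 x v : 0 <= update N x v.
Proof. exact: resp_ge0. Qed.

Lemma update_le_sup x v : update N x v <= resp_sup (resp N v).
Proof. exact: le_resp_sup. Qed.

Lemma le_fsum (A : set V) (f g : V -> R) : finite_set A ->
  (forall u, A u -> f u <= g u) -> \sum_(u \in A) f u <= \sum_(u \in A) g u.
Proof.
move=> finA fg; rewrite !fsbig_finite//= !big_seq; apply: ler_sum => u.
by rewrite in_fset_set// inE; exact: fg.
Qed.

Lemma update_homo x y : (forall v, x v <= y v) ->
  forall v, update N x v <= update N y v.
Proof.
move=> xy v; apply: resp_nd; rewrite lerD2r; apply: le_fsum.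
  exact: edge_finite.
by move=> u _; rewrite ler_wpM2l ?weight_ge0.
Qed.

Lemma iter_update_homo k x y : (forall v, x v <= y v) ->
  forall v, iter k (update N) x v <= iter k (update N) y v.
Proof.
move=> xy; elim: k => [//|k IH] v; exact: update_homo.
Qed.

End update_theory.

(** The update at a vertex only reads the mark of this vertex and its
out-neighbourhood, hence it commutes with every map that is a bijection on that
out-neighbourhood and preserves marks there; truncations, isomorphisms and
relabellings are all instances. *)
Lemma update_morph {R : realType} {T : completePseudoMetricType R}
    {V V' : choiceType} (N : network T V) (N' : network T V') (s : V -> V')
    (x : V -> R) (x' : V' -> R) (v : V) :
  set_bij [set u | edge N v u] [set u | edge N' (s v) u] s ->
  vmark N' (s v) = vmark N v ->
  (forall u, edge N v u -> emark N' (s v) (s u) = emark N v u) ->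
  (forall u, edge N v u -> x' (s u) = x u) ->
  update N' x' (s v) = update N x v.
Proof.
move=> sbij mv me xx'; rewrite /update /resp /shock mv; congr (resp_fun _ (_ + _)).
rewrite (reindex_fsbig s [set u | edge N v u])//.
apply: eq_fsbigr => u; rewrite inE /= => vu.
have svu : edge N' (s v) (s u) by case: sbij => + _ _; exact.
rewrite xx'// /weight vu svu me//; congr (_ / _ * _).
rewrite (reindex_fsbig s [set u | edge N v u])//.
by apply: eq_fsbigr => w; rewrite inE /= => vw; rewrite me.
Qed.

(** * Extremal equilibria of a finite network *)

Section pointwise_tarski.
Context {R : realType} {V : Type}.
Variables (F : (V -> R) -> V -> R) (m M : V -> R).
Hypothesis F_homo : forall x y, (forall v, x v <= y v) -> forall v, F x v <= F y v.
Hypothesis mF : forall x v, m v <= F x v.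
Hypothesis FM : forall x v, F x v <= M v.

(** Knaster-Tarski: the pointwise supremum of the points below their image is
the greatest fixed point, and dually for the least one. *)
Lemma greatest_fixpoint : exists2 x, x = F x &
  forall y, y = F y -> forall v, y v <= x v.
Proof.
pose S := [set y : V -> R | forall v, y v <= F y v].
pose z v := sup [set y v | y in S].
have Sz y : S y -> forall v, y v <= z v.
  move=> Sy v; apply: ub_le_sup; last by exists y.
  by exists (M v) => _ [t St <-]; exact: le_trans (St v) (FM _ _).
have zF v : z v <= F z v.
  apply: ge_sup; first by exists (m v), m => // u; exact: mF.
  by move=> _ [y Sy <-]; apply: le_trans (Sy v) _; apply: F_homo; exact: Sz.
exists z; last by move=> y yF; apply: Sz => v; rewrite -yF.
apply/funext => v; apply/le_anti; rewrite zF/=.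
by apply: Sz => u; exact: F_homo.
Qed.

Lemma least_fixpoint : exists2 x, x = F x &
  forall y, y = F y -> forall v, x v <= y v.
Proof.
pose S := [set y : V -> R | forall v, F y v <= y v].
pose z v := inf [set y v | y in S].
have Sz y : S y -> forall v, z v <= y v.
  move=> Sy v; apply: ge_inf; last by exists y.
  by exists (m v) => _ [t St <-]; exact: le_trans (mF _ _) (St v).
have zF v : F z v <= z v.
  apply: lb_le_inf; first by exists (M v), M => // u; exact: FM.
  by move=> _ [y Sy <-]; apply: le_trans (Sy v); apply: F_homo; exact: Sz.
exists z; last by move=> y yF; apply: Sz => v; rewrite -yF.
apply/funext => v; apply/le_anti; rewrite zF/= andbT.
by apply: Sz => u; exact: F_homo.
Qed.

End pointwise_tarski.

Section equilibria.
Context {R : realType} {T : completePseudoMetricType R} {n : nat}.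
Variable N : network T 'I_n.
Implicit Types x y : 'I_n -> R.

Lemma fsum_ord (A : set 'I_n) (f : 'I_n -> R) :
  \sum_(i \in A) f i = \sum_i (if i \in A then f i else 0).
Proof.
rewrite fsbig_mkcond (@fsbigE _ _ _ _ _ (index_enum 'I_n)) ?index_enum_uniq//.
  by apply: eq_bigl => i; rewrite in_setT.
by move=> i _ /negP[]; exact: mem_index_enum.
Qed.

Lemma equilibriumE x : equilibrium N x <-> x = update N x.
Proof.
have updE i : update N x i = resp N i (\sum_j weight N i j * x j + shock N i).
  rewrite /update fsum_ord; congr (resp_fun _ (_ + _)); apply: eq_bigr => j _.
  by case: ifPn => //; rewrite notin_setE /= /weight => /negP/negbTE ->; rewrite mul0r.
split=> [ex|xE i]; last by rewrite -updE -xE.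
by apply/funext => i; rewrite updE.
Qed.

Lemma least_equilibrium_ex : exists x, least_equilibrium N x.
Proof.
have [x xE xle] := least_fixpoint (@update_homo _ _ _ N) (@update_ge0 _ _ _ N)
  (@update_le_sup _ _ _ N).
by exists x; split=> [|y /equilibriumE]; [exact/equilibriumE|exact: xle].
Qed.

Lemma greatest_equilibrium_ex : exists x, greatest_equilibrium N x.
Proof.
have [x xE xge] := greatest_fixpoint (@update_homo _ _ _ N)
  (@update_ge0 _ _ _ N) (@update_le_sup _ _ _ N).
by exists x; split=> [|y /equilibriumE]; [exact/equilibriumE|exact: xge].
Qed.

(** Every equilibrium is a fixed point of a monotone map and lies between the
two initial conditions, so that the iterates keep enclosing it. *)
Lemma equilibrium_between x k i : equilibrium N x ->
  iter k (update N) (fun=> 0) i <= x i <=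
  iter k (update N) (fun j => resp_sup (resp N j)) i.
Proof.
move=> /equilibriumE xE; have xk : iter k (update N) x = x.
  by elim: k => //= k ->.
rewrite -[x in X in X && _]xk -[x in X in _ && X]xk; apply/andP; split.
  by apply: iter_update_homo => j; rewrite xE update_ge0.
by apply: iter_update_homo => j; rewrite xE update_le_sup.
Qed.

End equilibria.

(** * Continuity of the root iterates in the local topology *)

Lemma response_cvgP {R : realType} {I : Type} (F : set_system I) {FF : Filter F}
    (f : I -> response R) (f0 : response R) :
  f i @[i --> F] --> f0 <->
  forall e, 0 < e -> \forall i \near F, resp_dist f0 (f i) < e.
Proof. by rewrite cvg_ballP. Qed.

Lemma response_eval_cvg {R : realType} {I : Type} (F : set_system I)
    {FF : Filter F} (f : I -> response R) (f0 : response R) (z : I -> R) (z0 : R) :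
  f i @[i --> F] --> f0 -> z i @[i --> F] --> z0 ->
  f i (z i) @[i --> F] --> f0 z0.
Proof.
move=> /response_cvgP ff0 zz0; apply/cvgrPdist_lt => e e0.
have e20 : 0 < e / 2 by rewrite divr_gt0.
near=> i; rewrite [e]splitr; apply: le_lt_trans (ler_distD (f0 (z i)) _ _) _.
apply: ltrD; last first.
  by apply: le_lt_trans (resp_dist_ub _ _ _) _; near: i; exact: ff0.
have [_ _ _ /(_ (z0, z i))] := resp_admissible f0.
move=> /(_ (conj Logic.I Logic.I)) /=; rewrite mul1r => /le_lt_trans; apply.
by near: i; move/cvgrPdist_lt : zz0; apply.
Unshelve. all: by end_near. Qed.

Lemma dist_resp_sup {R : realType} (f g : response R) :
  `|resp_sup f - resp_sup g| <= resp_dist f g.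
Proof.
have le (f1 f2 : response R) : resp_sup f1 - resp_sup f2 <= resp_dist f1 f2.
  rewrite lerBlDr; apply: ge_sup; first by exists (f1 0), 0.
  move=> _ [z _ <-]; rewrite -lerBlDr; apply: le_trans (resp_dist_ub f1 f2 z).
  by apply: le_trans (ler_norm _); rewrite lerD2l lerN2 le_resp_sup.
by rewrite ler_norml lerNl opprB le andbT resp_dist_sym le.
Qed.

Section update_continuity.
Context {R : realType} {T : completePseudoMetricType R} {V : choiceType}.
Context {I : Type} (F : set_system I) {FF : Filter F}.
Variables (N : network T V) (M : I -> network T V).
Hypothesis edgeM : forall i, edge (M i) = edge N.
Hypothesis vmarkM : forall v, vmark (M i) v @[i --> F] --> vmark N v.
Hypothesis emarkM : forall v u, edge N v u ->
  (emark (M i) v u)%:num @[i --> F] --> (emark N v u)%:num.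

Lemma resp_cvg v : resp (M i) v @[i --> F] --> resp N v.
Proof.
apply: (cvg_comp (fun i => vmark (M i) v) snd (@vmarkM v)); exact: cvg_snd.
Qed.

Lemma fsum_cvg (A : set V) (f : I -> V -> R) (f0 : V -> R) : finite_set A ->
  (forall u, A u -> f i u @[i --> F] --> f0 u) ->
  \sum_(u \in A) f i u @[i --> F] --> \sum_(u \in A) f0 u.
Proof.
move=> finA ff0.
have sumE (h : V -> R) :
    \sum_(u \in A) h u = \sum_(u <- finmap.enum_fset (fset_set A) | u \in A) h u.
  by rewrite fsbig_finite//= big_seq; apply: eq_bigl => u; rewrite in_fset_set.
rewrite sumE; under eq_fun do rewrite sumE.
apply: cvg_big => [|u]; first exact: add_continuous.
by rewrite inE; exact: ff0.
Qed.

Lemma weight_cvg v u : edge N v u ->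
  weight (M i) v u @[i --> F] --> weight N v u.
Proof.
move=> vu; rewrite /weight vu; under eq_fun do rewrite edgeM vu.
have fin := edge_finite N v.
apply: cvgM; first exact: emarkM.
apply: cvgV; last by apply: fsum_cvg => // w; exact: emarkM.
rewrite gt_eqF// (fsbigD1 u)//=.
by rewrite ltr_pwDl// fsumr_ge0.
Qed.

Lemma update_cvg (x : I -> V -> R) (x0 : V -> R) v :
  (forall u, x i u @[i --> F] --> x0 u) ->
  update (M i) (x i) v @[i --> F] --> update N x0 v.
Proof.
move=> xx0; rewrite /update; apply: response_eval_cvg; first exact: resp_cvg.
apply: cvgD; last first.
  apply: (cvg_comp (fun i => vmark (M i) v) (snd \o fst) (@vmarkM v)).
  by apply: (cvg_comp fst snd); [exact: cvg_fst|exact: cvg_snd].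
under eq_fun do rewrite edgeM.
apply: fsum_cvg => [|u vu]; first exact: edge_finite.
by apply: cvgM; [exact: weight_cvg|exact: xx0].
Qed.

Lemma iter_update_cvg (x : I -> V -> R) (x0 : V -> R) k :
  (forall u, x i u @[i --> F] --> x0 u) -> forall v,
  iter k (update (M i)) (x i) v @[i --> F] --> iter k (update N) x0 v.
Proof.
move=> xx0; elim: k => [//|k IH] v /=.
exact: (@update_cvg (fun i => iter k (update (M i)) (x i))).
Qed.

End update_continuity.

(** Treats both extremal iterates at once: [g] is zero for the lower one and
[resp_sup] for the upper one. *)
Definition iterate_from {R : realType} {T : completePseudoMetricType R}
    (g : response R -> R) (N : rooted_network T) (k : nat) : R :=
  root_iterate (fun v => g (@resp R T {classic vtx N} N v)) k.

Section iterate_locality.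
Context {R : realType} {T : completePseudoMetricType R}.
Variable g : response R -> R.
Implicit Types a b N : rooted_network T.

Lemma reach_within_edge N j (v u : vtx N) :
  reach_within j v -> edge N v u -> reach_within j.+1 u.
Proof.
move=> [p [pp pv] pj] vu; exists (rcons p u); last by rewrite size_rcons.
by split; rewrite ?last_rcons// rcons_path pp pv.
Qed.

Lemma sval_trunc_inj N k : injective (@sval _ _ : trunc_vtx N k -> vtx N).
Proof. by move=> [v hv] [u hu] /= vu; subst u; congr exist; exact: Prop_irrelevance. Qed.

(** Each update moves information by one edge towards the root, so after [j]
updates the values are right at the vertices within distance [k - j]. *)
Lemma iterate_trunc N k : iterate_from g (trunc N k) k = iterate_from g N k.
Proof.
pose x0t : {classic vtx (trunc N k)} -> R :=
  fun v => g (@resp R T {classic vtx (trunc N k)} (trunc N k) v).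
pose x0 : {classic vtx N} -> R := fun v => g (@resp R T {classic vtx N} N v).
have H j (v : trunc_vtx N k) : (j <= k)%N -> reach_within (k - j) (sval v) ->
    iter j (@update R T {classic vtx (trunc N k)} (trunc N k)) x0t v =
    iter j (@update R T {classic vtx N} N) x0 (sval v).
  elim: j v => [//|j IH] v jk rv /=.
  have kj : (k - j = (k - j.+1).+1)%N by rewrite subnSK.
  have lt : (k - j.+1 < k)%N by rewrite ltn_subrL/= (leq_ltn_trans _ jk).
  apply/esym; apply: (@update_morph R T {classic vtx (trunc N k)}
    {classic vtx N} (trunc N k) N (@sval _ _)) => //.
    split.
    - by move=> u /= /andP[].
    - by move=> u w _ _; exact: sval_trunc_inj.
    - move=> u /= vu; have ru : reach_within k u.
        have [p pu pk] := reach_within_edge rv vu.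
        by exists p => //; exact: leq_trans pk lt.
      exists (exist _ u ru) => //=; rewrite /trunc_edge /= vu/=.
      apply/asboolP; case: rv => p pv pk; exists p => //.
      exact: leq_ltn_trans pk lt.
  move=> u /= /andP[vu _]; apply/esym/IH; first exact: ltnW.
  by rewrite kj; exact: reach_within_edge vu.
rewrite /iterate_from /root_iterate; apply: (H k (root (trunc N k))) => //.
by rewrite subnn; exists [::].
Qed.

(** Reading the marks of [b] along isomorphisms puts all networks close to [a]
on the same directed graph, where marks can be compared vertex by vertex. *)
Definition pullback a b (phi : vtx a -> vtx b) : network T (vtx a) :=
  Network (edge_finite a) (fun v => vmark b (phi v))
    (fun v u => emark b (phi v) (phi u)).

Lemma iterate_pullback a b (phi : vtx a -> vtx b) k : graph_isos a b phi ->
  iterate_from g (RootedNetwork (root a) (pullback phi)) k = iterate_from g b k.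
Proof.
move=> [[psi phiK psiK] phir phie].
rewrite /iterate_from /root_iterate /= -phir.
elim: k (root a) => [//|k IH] v /=.
apply/esym; apply: (@update_morph R T {classic vtx a} {classic vtx b}
  (pullback phi) b phi) => //.
split.
- by move=> u /=; rewrite phie.
- by move=> u w _ _; exact: (can_inj phiK).
- by move=> u /= vu; exists (psi u); rewrite ?psiK//= -phie psiK.
Qed.

End iterate_locality.

Section iterate_continuity.
Context {R : realType} {T : completePseudoMetricType R}.
Variable D : mark_metric T.
Variable g : response R -> R.
Hypothesis g_lip : forall f f' : response R, `|g f - g f'| <= resp_dist f f'.
Implicit Types a b : rooted_network T.

(** Along isomorphisms of vanishing cost the pulled back marks converge at each
vertex, and the iterate at the root is a continuous function of these marks. The
convergence is along the filter [F] of pairs of a network and an isomorphism of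
small cost, which avoids choosing one isomorphism per network. *)
Lemma iterate_iso_cvg a k e : 0 < e -> exists2 d, 0 < d &
  forall b (phi : vtx a -> vtx b), graph_isos a b phi -> iso_cost D phi < d ->
  `|iterate_from g a k - iterate_from g b k| < e.
Proof.
move=> e0.
pose J := {b : rooted_network T & vtx a -> vtx b}.
pose near_a (d : R) : set J :=
  [set i | graph_isos a (projT1 i) (projT2 i) /\ iso_cost D (projT2 i) < d].
pose F : set_system J := filter_from [set d | 0 < d] near_a.
have FF : Filter F.
  apply: filter_from_filter; first by exists 1 => /=.
  move=> d1 d2 /= d10 d20; exists (Num.min d1 d2); first by rewrite /= lt_min d10.
  by move=> i [ii]; rewrite lt_min => /andP[? ?]; split.
pose M (i : J) : network T {classic vtx a} := pullback (projT2 i).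
have vM v : vmark (M i) v @[i --> F] --> vmark a v.
  move=> A /(mark_dist_nbhs D)[d /= d0 dA].
  exists (Num.min d 1); first by rewrite /= lt_min d0/=.
  move=> [b phi] [/= _ cost]; apply: dA => /=.
  have := le_lt_trans (iso_cost_V D phi v) cost.
  by rewrite /dV gt_min !lt_min ltxx andbF/= => /andP[].
have eM v u : edge a v u ->
    (emark (M i) v u)%:num @[i --> F] --> (emark a v u)%:num.
  move=> vu; rewrite -[(emark a v u)%:num]lnK ?posrE//.
  rewrite (_ : (fun i => _) = expR \o (fun i => ln (emark (M i) v u)%:num)); last first.
    by apply/funext => i /=; rewrite lnK ?posrE.
  apply: continuous_cvg; first exact: continuous_expR.
  apply/cvgrPdist_lt => d d0; exists (Num.min d 1); first by rewrite /= lt_min d0/=.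
  move=> [b phi] [/= _ cost]; have := le_lt_trans (iso_cost_E D phi vu) cost.
  by rewrite /dE gt_min !lt_min ltxx andbF/= => /andP[].
have x0M v : g (resp (M i) v) @[i --> F] --> g (resp (a : network T {classic vtx a}) v).
  apply/cvgrPdist_lt => d d0.
  have /response_cvgP /(_ _ d0) : resp (M i) v @[i --> F] --> resp (a : network T {classic vtx a}) v.
    exact: resp_cvg.
  by apply: filterS => i; exact: le_lt_trans.
have := @iter_update_cvg R T {classic vtx a} J F FF a M (fun=> erefl) vM eM _ _ k
  x0M (root a).
move=> /cvgrPdist_lt/(_ e e0)[d /= d0 dF].
exists d => // b phi iphi cost.
by rewrite -(iterate_pullback g k iphi); exact: (dF (existT _ b phi)).
Qed.

Lemma dloc_term_le a b k : dloc_term D a b k <= dloc D a b.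
Proof.
have t0 r : 0 <= dloc_term D a b r by have /andP[] := dloc_term_itv D a b r.
apply: limr_ge; first exact: is_cvg_dloc.
exists k.+1 => // n /= kn; rewrite /series/= (bigD1_seq k)//=.
- by rewrite lerDl sumr_ge0.
- by rewrite mem_index_iota.
- exact: iota_uniq.
Qed.

(** The iterate of order [k] is determined by the truncation of order [k], and
networks at small local distance have almost isometric truncations. *)
Lemma iterate_dloc_cvg a k e : 0 < e -> exists2 d, 0 < d &
  forall b, dloc D a b < d -> `|iterate_from g a k - iterate_from g b k| < e.
Proof.
move=> e0; have [d d0 dP] := iterate_iso_cvg (trunc a k) k e0.
pose d1 := Num.min d 1 / 2.
have d10 : 0 < d1 by rewrite divr_gt0// lt_min d0/=.
have p0 : 0 < 2^-1 ^+ k.+1 :> R by rewrite exprn_gt0// invr_gt0.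
exists (2^-1 ^+ k.+1 * d1); first by rewrite mulr_gt0.
move=> b /(le_lt_trans (dloc_term_le a b k)); rewrite /dloc_term ltr_pM2l// => ab.
have d1d : d1 + d1 <= d by rewrite /d1 -splitr ge_min lexx.
have d11 : d1 + d1 <= 1 by rewrite /d1 -splitr ge_min lexx orbT.
(* without an isomorphism the truncations are at distance 1, more than [d1] *)
have iso : graph_isos (trunc a k) (trunc b k) !=set0.
  by apply: contrapT => niso; move: ab; rewrite /dtrunc asboolF//; lra.
have [phi iphi cost] := dtrunc_adherent D iso d10.
rewrite -(iterate_trunc g a) -(iterate_trunc g b); apply: (dP _ phi) => //.
by lra.
Qed.

(** The choice of the representative is immaterial: the continuity estimate
forces the iterates of networks at local distance zero to coincide. *)
Definition class_iterate k (x : rooted_space D) : R := iterate_from g (repr x) k.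

Lemma class_iterateE a k : class_iterate k (rooted_class D a) = iterate_from g a k.
Proof.
apply/eqP; rewrite -subr_eq0 -normr_le0; apply/ler_addgt0Pr => e e0; rewrite add0r.
have [d d0 dP] := iterate_dloc_cvg a k e0.
rewrite distrC ltW// dP//.
have /eqP : a = repr (rooted_class D a) %[mod rooted_space D] by rewrite reprK.
by rewrite eqquotE => /eqP ->.
Qed.

Lemma class_iterate_continuous k : continuous (class_iterate k).
Proof.
move=> x; apply/(@cvgrPdist_lt R R _ (nbhs x) (nbhs_filter x)) => e e0.
have [d d0 dP] := iterate_dloc_cvg (repr x) k e0.
apply/nbhs_ballP; exists d => // y; exact: dP.
Qed.

End iterate_continuity.

(** * Order and bounds for the root iterates *)

Section iterate_order.
Context {R : realType} {T : completePseudoMetricType R}.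
Implicit Types N : rooted_network T.

Lemma lower_iterate_nd N : nondecreasing_seq (lower_iterate N).
Proof.
apply/nondecreasing_seqP => k; rewrite /lower_iterate /root_iterate iterSr.
by apply: iter_update_homo => v; exact: update_ge0.
Qed.

Lemma lower_iterate_cvg N : cvgn (lower_iterate N).
Proof.
apply: nondecreasing_is_cvgn; first exact: lower_iterate_nd.
exists (resp_sup (@resp R T {classic vtx N} N (root N))) => _ [[|k] _ <-].
  exact: resp_sup_ge0.
exact: update_le_sup.
Qed.

Lemma iterate_rooted_at n (g : response R -> R) (N : network T 'I_n) i k :
  iterate_from g (rooted_at N i) k =
  iter k (update N) (fun j => g (resp N j)) i.
Proof.
have iE : i = vtx_ord (root (rooted_at N i)) by exact: val_inj.
rewrite [in RHS]iE /iterate_from /root_iterate.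
elim: k (root _) => [//|k IH] v; rewrite !iterS; apply/esym.
have := @update_morph R T {classic @ord_vtx n} 'I_n (rooted_at N i) N (@vtx_ord n) _ _ v.
apply => //.
split => //.
- by move=> [u hu] [w hw] _ _ [uw]; subst w; congr exist; exact: Prop_irrelevance.
- have ordK (u : 'I_n) : vtx_ord (exist _ (val u) (ltn_ord u)) = u.
    exact: val_inj.
  move=> u vu; exists (exist _ (val u) (ltn_ord u)); last exact: ordK.
  by rewrite /= /ord_edge ordK.
Qed.

End iterate_order.

(** * Measurability *)

Lemma continuous_borel_measurable {R : realType} {S : ptopologicalType}
    (h : S -> R) : continuous h ->
  measurable_fun setT (h : g_sigma_algebraType (@open S) -> R).
Proof.
move=> /continuousP ch; apply: (measurability _ (RGenOpens.measurableE R)).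
move=> _ [_ [a [b ->]] <-]; rewrite setTI.
by apply: sub_sigma_algebra; apply: ch; exact: interval_open.
Qed.

Lemma measurable_rsum {R : realType} {d} {X : measurableType d} {I : Type}
    (s : seq I) (h : I -> X -> R) : (forall i, measurable_fun setT (h i)) ->
  measurable_fun setT (fun w => \sum_(i <- s) h i w).
Proof.
move=> mh; elim: s => [|i s IH].
  by under eq_fun do rewrite big_nil; exact: measurable_cst.
by under eq_fun do rewrite big_cons; exact: measurable_funD.
Qed.

(** Over nonnegative functions, where the inverse of zero is zero, [t < S^-1]
always holds for negative [t] and means [0 < S] and [S * t < 1] otherwise. *)
Lemma measurable_nonneg_inv {R : realType} {d} {X : measurableType d} (S : X -> R) :
  (forall w, 0 <= S w) -> measurable_fun setT S ->
  measurable_fun setT (fun w => (S w)^-1).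
Proof.
move=> S0 mS; apply: (measurability _ (RGenOInfty.measurableE R)).
move=> _ [_ [t ->] <-]; rewrite setTI.
have [t0|t0] := ltP t 0.
  rewrite (_ : _ @^-1` _ = setT)//; apply/seteqP; split => // w _ /=.
  by rewrite in_itv/= andbT (lt_le_trans t0)// invr_ge0.
rewrite (_ : _ @^-1` _ = (fun w => (0 < S w) && (S w * t < 1)) @^-1` [set true]).
  rewrite -[X in measurable X]setTI.
  apply: measurable_and => //; apply: measurable_fun_ltr => //.
  by apply: measurable_funM.
apply/seteqP; split => w /=; rewrite in_itv/= andbT.
  move=> tS; have Sp : 0 < S w by rewrite -invr_gt0 (le_lt_trans t0).
  by rewrite Sp/= mulrC -ltr_pdivlMr// div1r.
by move=> /andP[Sp]; rewrite mulrC -ltr_pdivlMr// div1r.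
Qed.

Section finite_measurability.
Context {R : realType} {T : completePseudoMetricType R} {n : nat}.
Context {d} {Om : measurableType d}.
Variable G : Om -> network T 'I_n.
Hypothesis randG : random_network measurable G.

Lemma measurable_mark (h : vertex_mark R T -> R) v : continuous h ->
  measurable_fun setT (fun w => h (vmark (G w) v)).
Proof.
move=> /continuousP ch; apply: (measurability _ (RGenOpens.measurableE R)).
move=> _ [_ [a [b ->]] <-]; rewrite setTI.
apply: (proj1 randG v (h @^-1` `]a, b[)).
by apply: sub_sigma_algebra; apply: ch; exact: interval_open.
Qed.

Lemma measurable_resp (g : response R -> R) v : continuous g ->
  measurable_fun setT (fun w => g (resp (G w) v)).
Proof.
move=> cg; apply: (@measurable_mark (g \o snd)) => m.
by apply: (cvg_comp snd g); [exact: cvg_snd|exact: cg].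
Qed.

Lemma measurable_shock v : measurable_fun setT (fun w => shock (G w) v).
Proof.
apply: (@measurable_mark (snd \o fst)) => m.
by apply: (cvg_comp fst snd); [exact: cvg_fst|exact: cvg_snd].
Qed.

(** As the responses are continuous and nondecreasing, [c < f z] holds exactly
when [c < f q] for some rational [q < z]; this reduces the joint measurability
of the evaluation to evaluations at fixed points, which are continuous in the
response. *)
Lemma measurable_resp_eval (z : Om -> R) v : measurable_fun setT z ->
  measurable_fun setT (fun w => resp (G w) v (z w)).
Proof.
move=> mz; apply: (measurability _ (RGenOInfty.measurableE R)).
move=> _ [_ [c ->] <-]; rewrite setTI.
have eval_cont q : continuous (fun f : response R => f q).
  move=> f; apply: (@response_eval_cvg R _ (nbhs f) _ id f (fun=> q)) => //.
  exact: cvg_cst.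
rewrite (_ : _ @^-1` _ = \bigcup_(q : rat) (fun w =>
    (ratr q < z w) && (c < resp (G w) v (ratr q))) @^-1` [set true]).
  apply: bigcupT_measurable_rat => q; rewrite -[X in measurable X]setTI.
  apply: measurable_and => //; apply: measurable_fun_ltr => //.
  exact: (measurable_resp _ (eval_cont (ratr q))).
apply/seteqP; split => w /=; rewrite in_itv/= andbT; last first.
  by move=> [q _ /andP[/ltW qz /lt_le_trans]]; apply; exact: resp_nd.
(* a 1-Lipschitz response drops by less than its excess over [c] down to [q] *)
move=> cz; have /rat_in_itvoo[q] : z w - (resp (G w) v (z w) - c) < z w by lra.
rewrite in_itv/= => /andP[zq qz]; exists q => //=; rewrite qz/=.
have [_ _ _ /(_ (z w, ratr q) (conj Logic.I Logic.I))] := resp_admissible (resp (G w) v).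
rewrite /= mul1r [X in _ <= X]gtr0_norm ?subr_gt0// => /(le_trans (ler_norm _)).
by lra.
Qed.

Lemma measurable_exposure v u : measurable_fun setT (fun w =>
  if edge (G w) v u then (emark (G w) v u)%:num else 0 : R).
Proof.
have mE (B : set R) : measurable B ->
    measurable [set w | edge (G w) v u /\ B (emark (G w) v u)%:num].
  by move=> mB; exact: (proj2 randG).
move=> _ B mB; rewrite setTI.
have -> : (fun w => if edge (G w) v u then (emark (G w) v u)%:num else 0) @^-1` B =
    [set w | edge (G w) v u /\ B (emark (G w) v u)%:num] `|`
    (~` [set w | edge (G w) v u /\ setT (emark (G w) v u)%:num] `&` [set _ | B 0]).
  apply/seteqP; split => w /=; case: ifPn => vu.
  - by left.
  - by move=> B0; right; split=> // -[].
  - by move=> [[]//|[]/not_andP[]].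
  - by move=> [[]//|[]].
apply: measurableU; first exact: mE.
apply: measurableI; first by apply: measurableC; exact: mE.
have [B0|B0] := pselect (B 0).
  by rewrite (_ : [set _ | _] = setT); last by apply/seteqP; split.
by rewrite (_ : [set _ | _] = set0); last by apply/seteqP; split.
Qed.

Lemma measurable_weight v u : measurable_fun setT (fun w => weight (G w) v u).
Proof.
pose c u w : R := if edge (G w) v u then (emark (G w) v u)%:num else 0.
rewrite (_ : (fun w => _) = fun w => c u w * (\sum_j c j w)^-1).
  apply: measurable_funM; first exact: measurable_exposure.
  apply: measurable_nonneg_inv.
    by move=> w; apply: sumr_ge0 => j _; rewrite /c; case: ifP.
  by apply: measurable_rsum => j; exact: measurable_exposure.
apply/funext => w; rewrite /weight /c; case: ifP => _; last by rewrite mul0r.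
rewrite fsum_ord; congr (_ / _); apply: eq_bigr => j _.
by case: ifPn => [/set_mem /= ->//|]; rewrite notin_setE /= => /negP/negbTE ->.
Qed.

Lemma measurable_iter_update (g : response R -> R) k i : continuous g ->
  measurable_fun setT
    (fun w => iter k (update (G w)) (fun j => g (resp (G w) j)) i).
Proof.
move=> cg; elim: k i => [|k IH] i /=; first exact: measurable_resp.
apply: measurable_resp_eval; apply: measurable_funD; last exact: measurable_shock.
pose y j w := weight (G w) i j * iter k (update (G w)) (fun j => g (resp (G w) j)) j.
rewrite (_ : (fun w => _) = fun w => \sum_j y j w).
  apply: measurable_rsum => j; apply: measurable_funM; last exact: IH.
  exact: measurable_weight.
apply/funext => w; rewrite fsum_ord; apply: eq_bigr => j _.
case: ifPn => //; rewrite notin_setE /= => /negP/negbTE ij.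
by rewrite /y /weight ij mul0r.
Qed.

End finite_measurability.

(** * Integrals of bounded functions *)

Section bounded_functions.
Context {R : realType}.

Lemma bounded_funP {X : Type} (f : X -> R) :
  bounded_fun f <-> exists M, forall x, `|f x| <= M.
Proof.
split=> [[M [_ fM]]|[M fM]].
  by exists (M + 1) => x; apply: fM => //; rewrite ltrDl.
by exists M; split; first exact: num_real; move=> y My x _; exact: le_trans (fM x) (ltW My).
Qed.

Lemma lipschitz_bound (f : R -> R) : lipschitz f ->
  exists2 K, 0 <= K & forall x y, `|f x - f y| <= K * `|x - y|.
Proof.
move=> [M [_ fM]]; exists (`|M| + 1) => // x y.
have MM : M < `|M| + 1 by rewrite ltr_pwDr// ler_norm.
exact: (fM _ MM (x, y)).
Qed.

Lemma lipschitz_bound_continuous (f : R -> R) (K : R) :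
  (forall x y, `|f x - f y| <= K * `|x - y|) -> continuous f.
Proof.
move=> fK x; apply/cvgrPdist_lt => e e0.
have K1 : 0 < `|K| + 1 by rewrite ltr_pwDr.
near=> y; apply: le_lt_trans (fK x y) _.
apply: (@le_lt_trans _ _ ((`|K| + 1) * `|x - y|)).
  by rewrite ler_wpM2r// (le_trans (ler_norm K))// lerDl.
rewrite mulrC -ltr_pdivlMr//; near: y.
by apply: (@cvgr_dist_lt _ _ _ (nbhs x) _ id x) => //; rewrite divr_gt0.
Unshelve. all: by end_near. Qed.

Context {d} {X : measurableType d} (P : probability X R).
Implicit Types f g : X -> R.

Definition bounded_measurable f :=
  measurable_fun setT f /\ exists M, forall x, `|f x| <= M.

Lemma bounded_measurable_integrable f : bounded_measurable f ->
  P.-integrable setT (EFin \o f).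
Proof.
move=> [mf bf]; apply: measurable_bounded_integrable => //.
  by apply: le_lt_trans (probability_le1 P measurableT) _; rewrite ltry.
exact/bounded_funP.
Qed.

Lemma bounded_measurableB f g : bounded_measurable f -> bounded_measurable g ->
  bounded_measurable (fun x => f x - g x).
Proof.
move=> [mf [M fM]] [mg [N gN]]; split; first exact: measurable_funB.
by exists (M + N) => x; apply: le_trans (ler_normB _ _) _; exact: lerD.
Qed.

Lemma bounded_measurable_norm f : bounded_measurable f ->
  bounded_measurable (fun x => `|f x|).
Proof.
move=> [mf [M fM]]; split; first exact: measurableT_comp.
by exists M => x; rewrite normr_id.
Qed.

Lemma bounded_measurable_cst (c : R) : bounded_measurable (fun=> c).
Proof. by split; [exact: measurable_cst|exists `|c|]. Qed.

Lemma expectationE f : bounded_measurable f ->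
  ('E_P[f])%E = (\int[P]_x f x)%:E.
Proof.
move=> /bounded_measurable_integrable fi; rewrite unlock /Rintegral fineK//.
exact: integrable_fin_num.
Qed.

Lemma Rintegral_prob_cst (c : R) : \int[P]_x c = c.
Proof. by rewrite Rintegral_cst//= probability_setT mulr1. Qed.

Lemma le_dist_Rintegral f (c : R) : bounded_measurable f ->
  `|\int[P]_x f x - c| <= \int[P]_x `|f x - c|.
Proof.
move=> bf; have bc := bounded_measurable_cst c.
rewrite -{1}(Rintegral_prob_cst c) -RintegralB//; last 2 first.
  exact: bounded_measurable_integrable.
  exact: bounded_measurable_integrable.
apply: le_normr_Rintegral => //; apply: bounded_measurable_integrable.
exact: bounded_measurableB.
Qed.

Lemma bounded_convergence (f_ : nat -> X -> R) f M :
  (forall k, measurable_fun setT (f_ k)) -> measurable_fun setT f ->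
  (forall k x, `|f_ k x| <= M) ->
  {ae P, forall x, f_ k x @[k --> \oo] --> f x} ->
  \int[P]_x f_ k x @[k --> \oo] --> \int[P]_x f x.
Proof.
move=> mf_ mf fM cvg.
have [|||||fi _ cvgi] := @dominated_convergence _ X R P setT measurableT
    (fun k x => (f_ k x)%:E) (fun x => (f x)%:E) (fun=> M%:E).
- by move=> k; exact/measurable_EFinP.
- exact/measurable_EFinP.
- by apply: filterS cvg => x fx _; apply: cvg_EFin => //; exact: nearW.
- by apply: bounded_measurable_integrable; exact: bounded_measurable_cst.
- by apply: aeW => x k _; rewrite lee_fin.
apply: fine_cvg; rewrite fineK//; exact: integrable_fin_num fi.
Qed.

End bounded_functions.

(** * Empirical and limiting laws *)

Section laws.
Context {R : realType} {T : completePseudoMetricType R}.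
Variable D : mark_metric T.

Lemma ge0_integral_empirical n (N : network T 'I_n.+1) (h : rooted_space D -> R) :
  measurable_fun setT (h : rooted_borel D -> R) -> (forall y, 0 <= h y) ->
  (\int[empirical_law D N]_y (h y)%:E =
   (n.+1%:R^-1 * \sum_(i < n.+1) h (rooted_class D (rooted_at N i)))%:E)%E.
Proof.
move=> mh h0; have mEh : measurable_fun setT (EFin \o (h : rooted_borel D -> R)).
  exact/measurable_EFinP.
rewrite /empirical_law ge0_integral_mscale//=; last first.
  by move=> y _; rewrite lee_fin.
rewrite ge0_integral_measure_sum//=; last by move=> y _; rewrite lee_fin.
rewrite EFinM -sumEFin; congr (_ * _)%E; apply: eq_bigr => i _.
by rewrite integral_dirac//= diracT mul1e inord_val.
Qed.

Lemma integral_empirical n (N : network T 'I_n.+1) (h : rooted_space D -> R) :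
  continuous h ->
  \int[empirical_law D N]_y h y =
  n.+1%:R^-1 * \sum_(i < n.+1) h (rooted_class D (rooted_at N i)).
Proof.
move=> ch; have mh := continuous_borel_measurable ch.
rewrite /Rintegral integralE.
under eq_integral do rewrite funeposE -EFin_max.
under [X in (_ - X)%E]eq_integral do rewrite funenegE -EFinN -EFin_max.
have mcst : measurable_fun setT (fun _ : rooted_borel D => 0 : R) by exact: measurable_cst.
rewrite (@ge0_integral_empirical _ _ (fun y => Num.max (h y) 0)); last 2 first.
- exact: measurable_maxr.
- by move=> y; rewrite le_max lexx orbT.
rewrite (@ge0_integral_empirical _ _ (fun y => Num.max (- h y) 0)); last 2 first.
- by apply: measurable_maxr => //; exact: measurable_funN.
- by move=> y; rewrite le_max lexx orbT.
rewrite /= -mulrBr -sumrB; congr (_ * _); apply: eq_bigr => i _.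
by rewrite /Num.max; do !case: ifPn; lra.
Qed.

Lemma integral_law (P : probability (rooted_borel D) R)
    (d : measure_display) (Om : measurableType d) (Q : probability Om R)
    (X : Om -> rooted_space D) (h : rooted_space D -> R) :
  measurable_fun setT (X : Om -> rooted_borel D) ->
  (forall A : set (rooted_borel D), measurable A -> Q [set w | A (X w)] = P A) ->
  continuous h -> bounded_fun h ->
  \int[P]_y h y = \int[Q]_w h (X w).
Proof.
move=> mX lawX ch bh; rewrite /Rintegral; congr fine.
rewrite (_ : (\int[P]_y (h y)%:E)%E =
  (\int[pushforward Q (X : Om -> rooted_borel D)]_y (h y)%:E)%E); last first.
  by apply: eq_measure_integral => A mA _; apply/esym; exact: lawX.
rewrite integral_pushforward//=.
  by apply/measurable_EFinP; exact: continuous_borel_measurable.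
apply: (@bounded_measurable_integrable _ _ _ Q (h \o X)); split.
  by apply: (measurableT_comp (continuous_borel_measurable ch)).
by have [M hM] := proj1 (bounded_funP h) bh; exists M => w; exact: hM.
Qed.

End laws.

(** * Convergence in probability and in distribution *)

Section convergence.
Context {R : realType} (d : nat -> measure_display).
Context (Om : forall n, measurableType (d n)).
Variable Pr : forall n, probability (Om n) R.
Implicit Types X Y : forall n, Om n -> R.

Lemma measurable_deviation n (f : Om n -> R) (c e : R) :
  measurable_fun setT f -> measurable [set w | e < `|f w - c|].
Proof.
move=> mf; rewrite (_ : [set _ | _] = (fun w => e < `|f w - c|) @^-1` [set true])//.
rewrite -[X in measurable X]setTI; apply: measurable_fun_ltr => //.
by apply: measurableT_comp => //; apply: measurable_funB.
Qed.

Lemma eq_cvg_in_prob X Y (c : R) : (forall n, X n =1 Y n) ->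
  cvg_in_prob Pr X c -> cvg_in_prob Pr Y c.
Proof.
move=> XY Xc e e0; rewrite (_ : (fun n => _) = fun n => Pr n [set w | e < `|X n w - c|]).
  exact: Xc.
apply/funext => n; rewrite (_ : [set w | _] = [set w | e < `|X n w - c|])//.
by apply/funext => w /=; rewrite XY.
Qed.

(** A sequence trapped in windows of vanishing width whose centres and radii
converge in probability converges in probability. *)
Lemma cvg_in_prob_sandwich Y (c : R) :
  (forall n, measurable_fun setT (Y n)) ->
  (forall e, 0 < e -> exists X1 X2 c1 c2,
    [/\ cvg_in_prob Pr X1 c1, cvg_in_prob Pr X2 c2, `|c1 - c| <= e & c2 <= e] /\
    forall n, [/\ measurable_fun setT (X1 n), measurable_fun setT (X2 n)
      & {ae Pr n, forall w, `|Y n w - X1 n w| <= X2 n w}]) ->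
  cvg_in_prob Pr Y c.
Proof.
(* [X2 - c2], [c2], [X1 - c1] and [c1 - c] each take a quarter of [e] *)
move=> mY sandwich e e0; have e40 : 0 < e / 4 by rewrite divr_gt0.
have [X1 [X2 [c1 [c2 [[X1c X2c c1c c2e] X12]]]]] := sandwich _ e40.
pose A1 n := [set w | e / 4 < `|X1 n w - c1|].
pose A2 n := [set w | e / 4 < `|X2 n w - c2|].
apply: (@squeeze_cvge _ _ _ _ (cst 0%E) _ (fun n => Pr n (A1 n) + Pr n (A2 n))%E).
- apply: nearW => n; rewrite measure_ge0/=.
  have [mX1 mX2 [B [mB B0 BP]]] := X12 n.
  have mA1 : measurable (A1 n) by exact: measurable_deviation.
  have mA2 : measurable (A2 n) by exact: measurable_deviation.
  apply: (@le_trans _ _ (Pr n (A1 n `|` A2 n `|` B))).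
    apply: le_measure; rewrite ?inE//; first exact: measurable_deviation.
      by apply: measurableU => //; exact: measurableU.
    move=> w /= Yw; have [Bw|nBw] := pselect (B w); first by right.
    left; apply: contrapT => /not_orP[/negP nA1 /negP nA2].
    have {nBw} Y12 : `|Y n w - X1 n w| <= X2 n w.
      by apply: contrapT => nY; apply: nBw; exact: BP.
    move: nA1 nA2; rewrite -!leNgt => nA1 nA2.
    have := ler_distD (X1 n w) (Y n w) c; have := ler_distD c1 (X1 n w) c.
    have := ler_norm (X2 n w - c2).
    lra.
  apply: (@le_trans _ _ (Pr n (A1 n `|` A2 n) + Pr n B)%E).
    by apply: measureU2 => //; exact: measurableU.
  by rewrite (_ : Pr n B = 0%E)// adde0 measureU2.
- exact: cvg_cst.
- by rewrite -[X in _ --> X]adde0; apply: cvgeD => //; [exact: X1c|exact: X2c].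
Qed.

Lemma cvg_in_prob_expectation Y (c M : R) :
  (forall n, measurable_fun setT (Y n)) -> (forall n w, `|Y n w| <= M) ->
  cvg_in_prob Pr Y c -> \int[Pr n]_w Y n w @[n --> \oo] --> c.
Proof.
move=> mY YM Yc; apply/cvgrPdist_le => e e0.
(* a positive bound on the distance of [Y] to [c], paid on the rare event *)
pose K := M + `|c| + 1.
have K0 : 0 < K.
  by rewrite ltr_wpDl// addr_ge0// (le_trans _ (YM 0%N point)).
have e20 : 0 < e / 2 by rewrite divr_gt0.
have /fine_cvgP[_ /cvgrPdist_le /(_ (e / 2 / K))] := Yc _ e20.
rewrite divr_gt0// => /(_ isT); apply: filterS => n.
rewrite sub0r normrN /= => An.
have mA : measurable [set w | e / 2 < `|Y n w - c|] by exact: measurable_deviation.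
set A := [set w | _] in mA An.
have bY : bounded_measurable (Y n) by split; [exact: mY|exists M; exact: YM].
have bc := bounded_measurable_cst c (X := Om n).
have bA : bounded_measurable (fun w => K * \1_A w).
  split; first by apply: measurableT_comp => //; exact: measurable_indic.
  exists K => w; rewrite indicE; case: (_ \in _).
    by rewrite mulr1 ger0_norm// ltW.
  by rewrite mulr0 normr0 ltW.
rewrite distrC; apply: le_trans (le_dist_Rintegral _ _ bY) _.
apply: (@le_trans _ _ (\int[Pr n]_w (e / 2 + K * \1_A w))).
  apply: le_Rintegral => //.
  - apply: bounded_measurable_integrable; apply: bounded_measurable_norm.
    exact: bounded_measurableB.
  - apply: bounded_measurable_integrable; case: bA => m1 [M1 bA]; split.
      exact: measurable_funD.
    exists (e / 2 + M1) => w; apply: le_trans (ler_normD _ _) _.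
    by rewrite lerD// ger0_norm// ltW.
  move=> w _; rewrite indicE; case: (boolP (w \in A)) => [_|].
    rewrite mulr1; apply: le_trans (ler_normB _ _) _.
    by have := YM n w; rewrite /K; lra.
  by rewrite notin_setE /A /= => /negP; rewrite -leNgt mulr0 addr0.
rewrite RintegralD//; last 2 first.
  by apply: bounded_measurable_integrable; exact: bounded_measurable_cst.
  exact: bounded_measurable_integrable.
rewrite Rintegral_prob_cst (@RintegralZl _ _ _ (Pr n) setT \1_A K)//; last first.
  apply: bounded_measurable_integrable; split; first exact: measurable_indic.
  by exists 1 => w; rewrite indicE; case: (_ \in _); rewrite ?normr1 ?normr0.
rewrite /Rintegral integral_indic// setIT [leRHS]splitr lerD2l mulrC -ler_pdivlMr//.
by apply: le_trans An; exact: ler_norm.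
Qed.

End convergence.

Section inf_convolution.
Context {R : realType}.
Variables (psi : R -> R) (M : R).
Hypothesis psiM : forall x, `|psi x| <= M.

(** The largest [m]-Lipschitz function below [psi]. *)
Definition inf_convolution (m : nat) (x : R) : R :=
  inf (range (fun y => psi y + m%:R * `|x - y|)).

Let lbound_conv m x y : - M <= psi y + m%:R * `|x - y|.
Proof.
have := psiM y; rewrite ler_norml => /andP[My _].
by apply: le_trans My _; rewrite lerDl.
Qed.

Let has_inf_conv m x : has_inf (range (fun y => psi y + m%:R * `|x - y|)).
Proof.
split; first by exists (psi 0 + m%:R * `|x - 0|), 0.
by exists (- M) => _ [y _ <-]; exact: lbound_conv.
Qed.

Lemma inf_convolution_le m x y : inf_convolution m x <= psi y + m%:R * `|x - y|.
Proof. by apply: (inf_lbound (proj2 (has_inf_conv m x))); exists y. Qed.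

Lemma inf_convolution_le_self m x : inf_convolution m x <= psi x.
Proof. by have := inf_convolution_le m x x; rewrite subrr normr0 mulr0 addr0. Qed.

Lemma le_inf_convolution m x (c : R) :
  (forall y, c <= psi y + m%:R * `|x - y|) -> c <= inf_convolution m x.
Proof.
move=> cle; apply: lb_le_inf; first exact: (proj1 (has_inf_conv m x)).
by move=> _ [y _ <-].
Qed.

Lemma inf_convolution_bound m x : `|inf_convolution m x| <= M.
Proof.
rewrite ler_norml le_inf_convolution/=; last exact: lbound_conv.
apply: le_trans (inf_convolution_le_self m x) _.
exact: le_trans (ler_norm _) (psiM x).
Qed.

Lemma inf_convolution_lipschitz m x z :
  `|inf_convolution m x - inf_convolution m z| <= m%:R * `|x - z|.
Proof.
have le x1 x2 : inf_convolution m x1 - inf_convolution m x2 <= m%:R * `|x1 - x2|.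
  rewrite lerBlDr -lerBlDl; apply: le_inf_convolution => y; rewrite lerBlDl.
  apply: le_trans (inf_convolution_le m x1 y) _.
  rewrite addrCA -mulrDr lerD2l ler_wpM2l//; exact: ler_distD.
by rewrite ler_norml lerNl opprB le andbT distrC le.
Qed.

(** Away from [x] the penalty exceeds [2 * M], so that only the values of [psi]
near [x] enter the infimum once [m] is large. *)
Lemma inf_convolution_cvg x : {for x, continuous psi} ->
  inf_convolution m x @[m --> \oo] --> psi x.
Proof.
move=> /cvgrPdist_lt cx; apply/cvgrPdist_le => e e0.
have /nbhs_ballP[r /= r0 rP] := cx _ e0.
have M0 : 0 <= M by exact: le_trans (psiM 0).
have : \forall m \near \oo, 2 * M / r <= m%:R.
  exact: nbhs_infty_ger.
apply: filterS => m rm; rewrite ger0_norm ?subr_ge0 ?inf_convolution_le_self//.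
rewrite lerBlDr -lerBlDl; apply: le_inf_convolution => y.
have [xy|yx] := ltP `|x - y| r.
  have := rP y xy => /= /ltW; rewrite ler_norml => /andP[_].
  have : 0 <= m%:R * `|x - y| by rewrite mulr_ge0.
  lra.
have : 2 * M <= m%:R * `|x - y|.
  by rewrite ler_pdivrMr// in rm; apply: le_trans rm _; rewrite ler_wpM2l.
have := psiM x; have := psiM y; rewrite !ler_norml => /andP[+ _] /andP[_ +].
lra.
Qed.

End inf_convolution.

Section distribution.
Context {R : realType} (d : nat -> measure_display).
Context (Om : forall n, measurableType (d n)).
Variable Pr : forall n, probability (Om n) R.
Context (d' : measure_display) (Om' : measurableType d').
Variable Q : probability Om' R.

Lemma bounded_measurable_comp {e} {X : measurableType e} (psi : R -> R) (f : X -> R) :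
  continuous psi -> (exists M, forall x, `|psi x| <= M) -> measurable_fun setT f ->
  bounded_measurable (psi \o f).
Proof.
move=> cpsi [M psiM] mf; split; last by exists M => x; exact: psiM.
by apply: measurableT_comp => //; exact: continuous_measurable_fun.
Qed.

Lemma bounded_RintegralN {e} {X : measurableType e} (P : probability X R) (f : X -> R) :
  bounded_measurable f -> \int[P]_w (- f w) = - \int[P]_w f w.
Proof.
move=> bf; rewrite -mulN1r -RintegralZl//; last exact: bounded_measurable_integrable.
by congr fine; apply: eq_integral => w _; rewrite mulN1r.
Qed.

(** Bounded Lipschitz test functions determine convergence in distribution: a
bounded continuous function is the increasing limit of Lipschitz functions, which
bounds the lower limit of the expectations; apply this to [psi] and [- psi]. *)
Lemma cvg_in_distribution_lipschitz (X : forall n, Om n -> R) (Y : Om' -> R) :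
  (forall n, measurable_fun setT (X n)) -> measurable_fun setT Y ->
  (forall phi : R -> R, bounded_fun phi -> lipschitz phi ->
     \int[Pr n]_w phi (X n w) @[n --> \oo] --> \int[Q]_w phi (Y w)) ->
  cvg_in_distribution Pr X Q Y.
Proof.
move=> mX mY Xlip.
have lower (psi : R -> R) : continuous psi -> bounded_fun psi ->
    forall e, 0 < e -> \forall n \near \oo,
      \int[Q]_w psi (Y w) - e <= \int[Pr n]_w psi (X n w).
  move=> cpsi /bounded_funP bpsi e e0; have [M psiM] := bpsi.
  pose phi := inf_convolution psi.
  have phiM m x : `|phi m x| <= M by exact: inf_convolution_bound.
  have phi_lip m := inf_convolution_lipschitz psiM m.
  have cphi m : continuous (phi m) := lipschitz_bound_continuous (phi_lip m).
  have bphi m : exists M, forall x, `|phi m x| <= M by exists M => x; exact: phiM.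
  have : \int[Q]_w phi m (Y w) @[m --> \oo] --> \int[Q]_w psi (Y w).
    apply: (@bounded_convergence _ _ _ Q (fun m w => phi m (Y w)) _ M) => //.
    - by move=> m; case: (bounded_measurable_comp (cphi m) (bphi m) mY).
    - by case: (bounded_measurable_comp cpsi bpsi mY).
    - by apply: aeW => w; apply: (inf_convolution_cvg psiM); exact: cpsi.
  have e20 : 0 < e / 2 by rewrite divr_gt0.
  move=> /cvgrPdist_le/(_ _ e20)[m _ /(_ m (leqnn m)) /= Qm].
  have lphi : lipschitz (phi m).
    exists m%:R; split=> [|K mK [x z] _ /=]; first exact: num_real.
    by apply: le_trans (phi_lip m x z) _; rewrite ler_wpM2r// ltW.
  have bphi' : bounded_fun (phi m) by apply/bounded_funP.
  have := Xlip _ bphi' lphi.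
  move=> /cvgrPdist_le/(_ _ e20); apply: filterS => n Pn.
  have : \int[Pr n]_w phi m (X n w) <= \int[Pr n]_w psi (X n w).
    apply: le_Rintegral => //.
    - exact/bounded_measurable_integrable/(bounded_measurable_comp (cphi m)).
    - exact/bounded_measurable_integrable/(bounded_measurable_comp cpsi).
    - by move=> w _; exact: inf_convolution_le_self.
  move: Qm Pn; rewrite !ler_norml => /andP[_ ?] /andP[_ ?] ?; lra.
move=> psi cpsi bpsi; have bpsi' := proj1 (bounded_funP psi) bpsi.
rewrite (expectationE _ (bounded_measurable_comp cpsi bpsi' mY)).
apply/fine_cvgP; split.
  by apply: nearW => n; rewrite (expectationE _ (bounded_measurable_comp cpsi bpsi' (mX n))).
apply/cvgrPdist_le => e e0.
have cN : continuous (fun x => - psi x) by move=> x; apply: cvgN; exact: cpsi.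
have bN : bounded_fun (fun x => - psi x).
  by case: bpsi' => M psiM; apply/bounded_funP; exists M => x; rewrite normrN.
apply: filterS2 (lower _ cpsi bpsi _ e0) (lower _ cN bN _ e0) => n.
rewrite /= (expectationE _ (bounded_measurable_comp cpsi bpsi' (mX n))) /=.
rewrite (bounded_RintegralN _ (bounded_measurable_comp cpsi bpsi' (mX n))).
rewrite (bounded_RintegralN _ (bounded_measurable_comp cpsi bpsi' mY)) /=.
by rewrite ler_norml => ? ?; apply/andP; split; lra.
Qed.

End distribution.

Section uniform_vertex.
Context {R : realType} {d} {Om : measurableType d} (Pr : probability Om R).
Variables (F : set (set Om)) (n : nat) (o : Om -> 'I_n.+1) (y : 'I_n.+1 -> Om -> R).
Hypothesis Fmeas : F `<=` measurable.
Hypothesis Fy : forall i (B : set R), measurable B -> F [set w | B (y i w)].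
Hypothesis o_unif : uniform_given Pr F o.

Lemma measurable_vertex_value i : measurable_fun setT (y i).
Proof. by move=> _ B mB; rewrite setTI; apply: Fmeas; exact: Fy. Qed.

Lemma measurable_vertex_is i : measurable_fun setT (fun w => o w == i).
Proof.
apply: (measurable_fun_bool true); rewrite setTI.
rewrite (_ : _ @^-1` _ = [set w | o w = i]); first exact: (proj1 o_unif).
by apply/seteqP; split => w /= /eqP.
Qed.

Lemma measurable_uniform_value : measurable_fun setT (fun w => y (o w) w).
Proof.
move=> _ B mB; rewrite setTI.
rewrite (_ : _ @^-1` _ = \bigcup_(i in [set: 'I_n.+1])
    ([set w | B (y i w)] `&` [set w | o w = i])).
  apply: fin_bigcup_measurable => // i _; apply: measurableI.
    exact/Fmeas/Fy.
  exact: (proj1 o_unif).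
by apply/seteqP; split=> [w By|w [i _ [/= Bi oi]]]; [exists (o w)|rewrite /= oi].
Qed.

Lemma probability_vertex_is i : Pr [set w | o w = i] = (n.+1%:R^-1)%:E.
Proof.
have FT : F [set: Om] by rewrite (_ : setT = [set w | setT (y i w)])//; exact: Fy.
by have := proj2 o_unif i _ FT; rewrite setTI probability_setT mul1e.
Qed.

(** On the pairs with second coordinate true, the law of [(y i, o == i)] is the
law of [(y i, true)] divided by the number of vertices; integrating against both
laws transfers the uniformity of [o] from events to functions. *)
Lemma ge0_integral_vertex_is i (psi : R -> R) : continuous psi ->
  (forall x, 0 <= psi x) ->
  (\int[Pr]_(w in [set w | o w = i]) (psi (y i w))%:E =
  (n.+1%:R^-1)%:E * \int[Pr]_w (psi (y i w))%:E)%E.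
Proof.
move=> cpsi psi0.
have mi := measurable_vertex_is i; have my := measurable_vertex_value i.
pose a w := (y i w, o w == i); pose b w := (y i w, true).
have ma : measurable_fun setT a by exact: measurable_fun_pair.
have mb : measurable_fun setT b by exact: measurable_fun_pair.
pose E := [set z : R * bool | z.2].
have mE : measurable E.
  rewrite (_ : E = setT `*` [set true]); last first.
    by apply/seteqP; split=> [[u v] vt|[u v] [_ vt]].
  by apply: measurableX.
pose f (z : R * bool) : \bar R := (psi z.1)%:E.
have mf : measurable_fun setT f.
  apply/measurable_EFinP; apply: measurableT_comp => //.
  exact: continuous_measurable_fun.
have mfE : measurable_fun E f by exact: measurable_funTS.
have f0 z : (0 <= f z)%E by rewrite lee_fin.
have aE : a @^-1` E = [set w | o w = i].
  by apply/seteqP; split => w /= /eqP.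
have bE : b @^-1` E = setT by apply/seteqP; split.
transitivity (\int[pushforward Pr a]_(z in E) f z)%E.
  by rewrite ge0_integral_pushforward// aE.
have c0 : 0 <= n.+1%:R^-1 :> R by rewrite invr_ge0.
pose c : {nonneg R} := NngNum c0.
transitivity (\int[pushforward (mscale c Pr) b]_(z in E) f z)%E.
  apply: eq_measure_integral => A mA AE.
  have mB : measurable [set r | A (r, true)].
    by have := measurable_ysection true mA; rewrite /ysection /=; under eq_set do rewrite inE.
  transitivity (Pr ([set w | A (y i w, true)] `&` [set w | o w = i])).
    congr (Pr _); apply/seteqP; split=> w /=.
      by move=> Aw; have /= /eqP owi := AE _ Aw; rewrite /a owi eqxx in Aw.
    by move=> [Aw owi]; rewrite /a owi eqxx.
  by rewrite (proj2 o_unif i _ (Fy i mB)) muleC.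
rewrite ge0_integral_pushforward// bE ge0_integral_mscale//.
  exact: (measurableT_comp mf mb).
by move=> w _; exact: f0.
Qed.

Lemma integral_vertex_is i (psi : R -> R) : continuous psi ->
  (exists M, forall x, `|psi x| <= M) ->
  \int[Pr]_(w in [set w | o w = i]) psi (y i w) =
  n.+1%:R^-1 * \int[Pr]_w psi (y i w).
Proof.
move=> cpsi bpsi; have [M psiM] := bpsi.
have my := measurable_vertex_value i.
have mD : measurable [set w | o w = i] by exact: (proj1 o_unif).
have intp := bounded_measurable_integrable Pr (bounded_measurable_comp cpsi bpsi my).
have intc := bounded_measurable_integrable Pr (bounded_measurable_cst M).
have intpD := integrableS measurableT mD (@subsetT _ _) intp.
have intcD := integrableS measurableT mD (@subsetT _ _) intc.
(* the nonnegative case applies after a shift by the bound of [psi] *)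
have cM : continuous (fun x => psi x + M).
  by move=> x; apply: cvgD; [exact: cpsi|exact: cvg_cst].
have pM0 x : 0 <= psi x + M by have := psiM x; rewrite ler_norml; lra.
have /(congr1 fine) := ge0_integral_vertex_is i cM pM0.
rewrite fineM//; last first.
  by apply: integrable_fin_num => //; exact: integrableD intp intc.
rewrite -![fine (integral _ _ _)]/(Rintegral _ _ _) RintegralD// RintegralD//.
have -> : \int[Pr]_(w in [set w | o w = i]) M = M * n.+1%:R^-1.
  rewrite Rintegral_cst//; congr (_ * _).
  exact: (congr1 fine (probability_vertex_is i)).
rewrite Rintegral_prob_cst /=.
by rewrite mulrDr mulrC => /addIr.
Qed.

Lemma integral_uniform_vertex (psi : R -> R) : continuous psi ->
  (exists M, forall x, `|psi x| <= M) ->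
  \int[Pr]_w psi (y (o w) w) =
  \int[Pr]_w (n.+1%:R^-1 * \sum_(i < n.+1) psi (y i w)).
Proof.
move=> cpsi bpsi.
have mD i : measurable [set w | o w = i] by exact: (proj1 o_unif).
have bm i := bounded_measurable_comp cpsi bpsi (measurable_vertex_value i).
have int i := bounded_measurable_integrable Pr (bm i).
have bo := bounded_measurable_comp cpsi bpsi measurable_uniform_value.
transitivity (\sum_(i < n.+1) \int[Pr]_(w in [set w | o w = i]) psi (y i w)).
  rewrite /Rintegral.
  have -> : [set: Om] = \big[setU/set0]_(i <- index_enum 'I_n.+1) [set w | o w = i].
    by apply/seteqP; split => // w _; rewrite -bigcup_seq; exists (o w) => //=;
      rewrite mem_index_enum.
  rewrite integral_bigsetU_EFin//.
  - rewrite sum_fine; last first.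
      by move=> i _; apply: integrable_fin_num => //; exact: integrableS (int i).
    congr fine; apply: eq_bigr => i _.
    by apply: eq_integral => w /set_mem /= ->.
  - exact: index_enum_uniq.
  - by move=> i j _ _ [w [/= <- <-]].
  - by apply: measurable_funTS; apply/measurable_EFinP; case: bo.
under eq_bigr do rewrite (integral_vertex_is _ cpsi bpsi).
rewrite -mulr_sumr RintegralZl//.
  congr (_ * _); rewrite /Rintegral sum_fine; last first.
    by move=> i _; apply: integrable_fin_num => //; exact: int.
  rewrite -integral_sum//; congr fine; apply: eq_integral => w _.
  by rewrite sumEFin.
rewrite (_ : EFin \o _ = fun w => (\sum_(i < n.+1) (EFin \o (psi \o y i)) w)%E).
  by apply: integrable_sum.
by apply/funext => w /=; rewrite sumEFin.
Qed.

End uniform_vertex.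

(** * Averages of equilibria *)

Lemma response_lip_continuous {R : realType} (g : response R -> R) :
  (forall f f', `|g f - g f'| <= resp_dist f f') -> continuous g.
Proof.
move=> glip f; apply/(@cvgrPdist_lt R R _ (nbhs f) (nbhs_filter f)) => e e0.
apply/nbhs_ballP; exists e => // f'; exact: le_lt_trans.
Qed.

Section capped_distance.
Context {R : realType}.
Variables (M K : R).
Hypothesis (M0 : 0 <= M) (K0 : 0 <= K).

(** A bound on the variation, over a distance [t], of a [K]-Lipschitz function
bounded by [M]; the cap makes it an admissible test function. *)
Definition capped_distance (t : R) : R := Num.min (2 * M) (K * `|t|).

Lemma capped_distance_bound t : `|capped_distance t| <= 2 * M.
Proof.
rewrite ger0_norm ?ge_min ?lexx//.
by rewrite le_min !mulr_ge0.
Qed.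

Lemma capped_distance_continuous : continuous capped_distance.
Proof.
apply: (@lipschitz_bound_continuous _ _ K) => s t.
have : K * `| `|s| - `|t| | <= K * `|s - t| by rewrite ler_wpM2l// ler_dist_dist.
rewrite -{1}(ger0_norm K0) -normrM mulrBr /capped_distance /Num.min.
rewrite !ler_norml => /andP[? ?].
by do !case: ifPn; rewrite -?leNgt; lra.
Qed.

Lemma capped_distance0 : capped_distance 0 = 0.
Proof. by rewrite /capped_distance normr0 mulr0; apply/min_idPr; rewrite mulr_ge0. Qed.

Lemma dist_le_capped (phi : R -> R) l x u : (forall z, `|phi z| <= M) ->
  (forall z t, `|phi z - phi t| <= K * `|z - t|) -> l <= x <= u ->
  `|phi x - phi l| <= capped_distance (u - l).
Proof.
move=> phiM phiK /andP[lx xu]; rewrite /capped_distance le_min; apply/andP; split.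
  by rewrite mulr2n mulrDl mul1r (le_trans (ler_normB _ _))// lerD.
apply: le_trans (phiK x l) _; rewrite ler_wpM2l// !ger0_norm ?subr_ge0//.
  by rewrite lerD2r.
exact: le_trans xu.
Qed.

End capped_distance.

Section averages.
Context (R : realType) (T : completePseudoMetricType R) (D : mark_metric T).
Context (d : nat -> measure_display) (Om : forall n, measurableType (d n)).
Variable Pr : forall n, probability (Om n) R.
Variable G : forall n, Om n -> network T 'I_n.+1.
Hypothesis randG : forall n, random_network measurable (@G n).
Variable P : probability (rooted_borel D) R.
Context (d' : measure_display) (Om' : measurableType d').
Variables (Q : probability Om' R) (L : Om' -> rooted_network T).
Hypothesis measL : measurable_fun setT
  (fun w => rooted_class D (L w) : rooted_borel D).
Hypothesis lawL : forall A : set (rooted_borel D), measurable A ->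
  Q [set w | A (rooted_class D (L w))] = P A.
Hypothesis B1 : forall h : rooted_space D -> R, continuous h -> bounded_fun h ->
  cvg_in_prob Pr (fun n w => \int[empirical_law D (@G n w)]_y h y)
    (\int[P]_y h y).
Hypothesis B3 : {ae Q, forall w,
  (fun k => upper_iterate (L w) k - lower_iterate (L w) k) @ \oo --> (0 : R)}.

Let zero_lip (f f' : response R) : `|(0 : R) - 0| <= resp_dist f f'.
Proof. by rewrite subrr normr0 (le_trans _ (resp_dist_ub f f' 0)). Qed.

Let lowerC k : rooted_space D -> R := class_iterate (fun=> 0) k.
Let upperC k : rooted_space D -> R := class_iterate (@resp_sup R) k.

Let lowerC_continuous k : continuous (lowerC k).
Proof. exact: class_iterate_continuous. Qed.

Let upperC_continuous k : continuous (upperC k).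
Proof. by apply: class_iterate_continuous => f f'; exact: dist_resp_sup. Qed.

Let lowerCE a k : lowerC k (rooted_class D a) = lower_iterate a k.
Proof. exact: class_iterateE. Qed.

Let upperCE a k : upperC k (rooted_class D a) = upper_iterate a k.
Proof. by apply: class_iterateE => f f'; exact: dist_resp_sup. Qed.

Lemma measurable_lower_iterate k :
  measurable_fun setT (fun w => lower_iterate (L w) k).
Proof.
have := measurableT_comp (continuous_borel_measurable (@lowerC_continuous k)) measL.
by apply: eq_measurable_fun => w _; rewrite /= lowerCE.
Qed.

Lemma measurable_upper_iterate k :
  measurable_fun setT (fun w => upper_iterate (L w) k).
Proof.
have := measurableT_comp (continuous_borel_measurable (@upperC_continuous k)) measL.
by apply: eq_measurable_fun => w _; rewrite /= upperCE.
Qed.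

Definition limit_root (w : Om') : R := limn (lower_iterate (L w)).

Lemma limit_root_cvg w : lower_iterate (L w) @ \oo --> limit_root w.
Proof. exact: lower_iterate_cvg. Qed.

Lemma measurable_limit_root : measurable_fun setT limit_root.
Proof.
apply: (@measurable_fun_cvg _ _ _ _ (fun k w => lower_iterate (L w) k)).
  exact: measurable_lower_iterate.
by move=> w _; exact: limit_root_cvg.
Qed.

Lemma upper_iterate_cvg :
  {ae Q, forall w, upper_iterate (L w) @ \oo --> limit_root w}.
Proof.
apply: filterS B3 => w gap; have lw := limit_root_cvg (w := w).
rewrite -[limit_root w]add0r (_ : upper_iterate (L w) =
  (fun k => upper_iterate (L w) k - lower_iterate (L w) k) \+ lower_iterate (L w)).
  exact: cvgD gap lw.
by apply/funext => k /=; rewrite subrK.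
Qed.

Lemma empirical_average_cvg (h : rooted_space D -> R) :
  continuous h -> bounded_fun h ->
  cvg_in_prob Pr (fun n w =>
      n.+1%:R^-1 * \sum_(i < n.+1) h (rooted_class D (rooted_at (@G n w) i)))
    (\int[Q]_w h (rooted_class D (L w))).
Proof.
move=> ch bh; rewrite -(integral_law measL lawL ch bh).
by apply: eq_cvg_in_prob (B1 ch bh) => n w; rewrite integral_empirical.
Qed.

(** The equilibria lie between the lower and upper iterates of order [k], which
are local: the average over the equilibrium is within the average gap of the
average over the lower iterate. Both of these averages converge for fixed [k],
and their limits tend to the desired ones as [k] grows. *)
Lemma equilibrium_average_cvg (x : forall n, Om n -> 'I_n.+1 -> R) (phi : R -> R) :
  (forall n i, measurable_fun setT (fun w => x n w i)) ->
  (forall n, {ae Pr n, forall w, equilibrium (@G n w) (x n w)}) ->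
  bounded_fun phi -> lipschitz phi ->
  cvg_in_prob Pr (fun n w => n.+1%:R^-1 * \sum_(i < n.+1) phi (x n w i))
    (\int[Q]_w phi (limit_root w)).
Proof.
move=> mx eqx bphi lphi.
have [M phiM] := proj1 (bounded_funP phi) bphi.
have [K K0 phiK] := lipschitz_bound lphi.
have cphi := lipschitz_bound_continuous phiK.
have mphi := continuous_measurable_fun cphi.
have M0 : 0 <= M by exact: le_trans (phiM 0).
pose psi := capped_distance M K.
have cpsi : continuous psi by exact: capped_distance_continuous.
have mpsi := continuous_measurable_fun cpsi.
have psiM t : `|psi t| <= 2 * M by exact: capped_distance_bound.
have maverage n (f : 'I_n.+1 -> Om n -> R) : (forall i, measurable_fun setT (f i)) ->
    measurable_fun setT (fun w => n.+1%:R^-1 * \sum_i f i w).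
  by move=> mf; apply: measurableT_comp => //; exact: measurable_rsum.
pose low k n (i : 'I_n.+1) w := iter k (update (@G n w)) (fun=> 0) i.
pose upp k n (i : 'I_n.+1) w :=
  iter k (update (@G n w)) (fun j => resp_sup (resp (@G n w) j)) i.
have mlow k n i : measurable_fun setT (low k n i).
  apply: (@measurable_iter_update _ _ _ _ _ _ (randG n) (fun=> 0)).
  by apply: response_lip_continuous => f f'; exact: zero_lip.
have mupp k n i : measurable_fun setT (upp k n i).
  apply: (measurable_iter_update (randG n)).
  by apply: response_lip_continuous => f f'; exact: dist_resp_sup.
apply: cvg_in_prob_sandwich => [n|e e0].
  by apply: (maverage n (fun i w => phi (x n w i))) => i; exact: measurableT_comp.
have lim1 : \int[Q]_w phi (lower_iterate (L w) k) @[k --> \oo] -->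
    \int[Q]_w phi (limit_root w).
  apply: (@bounded_convergence _ _ _ Q
    (fun k w => phi (lower_iterate (L w) k)) _ M) => //.
  - by move=> k; apply: measurableT_comp => //; exact: measurable_lower_iterate.
  - by apply: measurableT_comp => //; exact: measurable_limit_root.
  - by apply: aeW => w; apply: continuous_cvg; [exact: cphi|exact: limit_root_cvg].
have lim2 : \int[Q]_w psi (upper_iterate (L w) k - lower_iterate (L w) k)
    @[k --> \oo] --> (0 : R).
  rewrite -[X in _ --> X](Rintegral_prob_cst Q 0).
  apply: (@bounded_convergence _ _ _ Q
    (fun k w => psi (upper_iterate (L w) k - lower_iterate (L w) k)) _ (2 * M)) => //.
  - move=> k; apply: measurableT_comp => //; apply: measurable_funB.
      exact: measurable_upper_iterate.
    exact: measurable_lower_iterate.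
  - apply: filterS B3 => w gap; rewrite -(capped_distance0 K M0).
    by apply: continuous_cvg; [exact: cpsi|exact: gap].
have [k _ near_k] : \forall k \near \oo,
    `|\int[Q]_w phi (limit_root w) - \int[Q]_w phi (lower_iterate (L w) k)| <= e /\
    `|0 - \int[Q]_w psi (upper_iterate (L w) k - lower_iterate (L w) k)| <= e.
  by apply: filterS2 (proj1 (cvgrPdist_le _ _) lim1 e e0)
    (proj1 (cvgrPdist_le _ _) lim2 e e0).
have /= [k1 k2] := near_k k (leqnn k).
exists (fun n w => n.+1%:R^-1 * \sum_i phi (low k n i w)).
exists (fun n w => n.+1%:R^-1 * \sum_i psi (upp k n i w - low k n i w)).
exists (\int[Q]_w phi (lower_iterate (L w) k)).
exists (\int[Q]_w psi (upper_iterate (L w) k - lower_iterate (L w) k)).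
split; last first.
  move=> n; split.
  - by apply: (maverage n (fun i w => phi (low k n i w))) => i; exact: measurableT_comp.
  - apply: (maverage n (fun i w => psi (upp k n i w - low k n i w))) => i.
    by apply: measurableT_comp => //; exact: measurable_funB.
  - apply: filterS (eqx n) => w exw; rewrite -mulrBr -sumrB normrM.
    rewrite ger0_norm ?invr_ge0// ler_wpM2l ?invr_ge0//.
    apply: le_trans (ler_norm_sum _ _ _) _; apply: ler_sum => i _.
    by apply: dist_le_capped => //; exact: equilibrium_between.
split.
- rewrite (_ : \int[Q]_w phi (lower_iterate (L w) k) =
      \int[Q]_w (phi \o lowerC k) (rooted_class D (L w))); last first.
    by congr fine; apply: eq_integral => w _; rewrite /= lowerCE.
  apply: eq_cvg_in_prob (@empirical_average_cvg (phi \o lowerC k) _ _).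
  + move=> n w; congr (_ * _); apply: eq_bigr => i _.
    by rewrite /= lowerCE; congr phi; exact: (iterate_rooted_at (fun=> 0)).
  + by move=> y; apply: continuous_comp; [exact: lowerC_continuous|exact: cphi].
  + by apply/bounded_funP; exists M => y; exact: phiM.
- pose gapC y := psi (upperC k y - lowerC k y).
  rewrite (_ : \int[Q]_w psi (upper_iterate (L w) k - lower_iterate (L w) k) =
      \int[Q]_w gapC (rooted_class D (L w))); last first.
    by congr fine; apply: eq_integral => w _; rewrite /gapC lowerCE upperCE.
  apply: eq_cvg_in_prob (@empirical_average_cvg gapC _ _).
  + move=> n w; congr (_ * _); apply: eq_bigr => i _.
    rewrite /gapC lowerCE upperCE; congr (psi (_ - _)).
      exact: (iterate_rooted_at (@resp_sup R)).
    exact: (iterate_rooted_at (fun=> 0)).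
  + move=> y; apply: (@continuous_comp _ _ _ (fun y => upperC k y - lowerC k y)).
      apply: (@cvgB _ _ _ (nbhs y) _ (upperC k) (lowerC k)).
        exact: (@upperC_continuous k y).
      exact: (@lowerC_continuous k y).
    exact: cpsi.
  + by apply/bounded_funP; exists (2 * M) => y; exact: psiM.
- by rewrite distrC.
- by move: k2; rewrite sub0r normrN; apply: le_trans; exact: ler_norm.
Qed.

End averages.

Theorem theorem4p2 (R : realType) (T : completePseudoMetricType R)
  (hausT : hausdorff_space T)
  (sepT : exists2 A : set T, countable A & dense A)
  (D : mark_metric T)
  (* the finite networks: the one of index n has vertex set 'I_n.+1 *)
  (d : nat -> measure_display) (Om : forall n, measurableType (d n))
  (Pr : forall n, probability (Om n) R)
  (G : forall n, Om n -> network T 'I_n.+1)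
  (randG : forall n, random_network measurable (@G n))
  (* the limiting law and a random rooted network with this law *)
  (P : probability (rooted_borel D) R)
  (d' : measure_display) (Om' : measurableType d') (Q : probability Om' R)
  (L : Om' -> rooted_network T)
  (measL : measurable_fun setT
             (fun w => rooted_class D (L w) : rooted_borel D))
  (lawL : forall A : set (rooted_borel D), measurable A ->
            Q [set w | A (rooted_class D (L w))] = P A)
  (fwdL : forall w, forward_connected (L w))
  (B1 : forall h : rooted_space D -> R, continuous h -> bounded_fun h ->
          cvg_in_prob Pr
            (fun n w => \int[empirical_law D (G n w)]_y h y)
            (\int[P]_y h y))
  (B2fin : forall n w (i : 'I_n.+1), admissible (resp (G n w) i))
  (B2lim : {ae Q, forall w, forall v : vtx (L w),
             admissible (@resp R T {classic vtx (L w)} (L w) v)})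
  (B3 : {ae Q, forall w,
          (fun k => upper_iterate (L w) k - lower_iterate (L w) k)
            @ \oo --> (0 : R)}) :
  (forall n w, exists x, least_equilibrium (G n w) x) /\
  (forall n w, exists x, greatest_equilibrium (G n w) x) /\
  exists xstar : {RV Q >-> R},
    {ae Q, forall w, lower_iterate (L w) @ \oo --> xstar w} /\
    {ae Q, forall w, upper_iterate (L w) @ \oo --> xstar w} /\
    forall x : forall n, Om n -> 'I_n.+1 -> R,
      (forall n i, measurable_fun setT (fun w => x n w i)) ->
      (forall n, {ae Pr n, forall w, equilibrium (G n w) (x n w)}) ->
      (forall phi : R -> R, bounded_fun phi -> lipschitz phi ->
         cvg_in_prob Pr
           (fun n w => n.+1%:R^-1 * \sum_(i < n.+1) phi (x n w i))
           (fine ('E_Q[phi \o xstar])%E)) /\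
      (forall (F : forall n, set (set (Om n))) (o : forall n, Om n -> 'I_n.+1),
         (forall n, sigma_algebra setT (F n)) ->
         (forall n, F n `<=` measurable) ->
         (forall n, random_network (F n) (@G n)) ->
         (forall n i (B : set R), measurable B ->
            F n [set w | B (x n w i)]) ->
         (forall n, uniform_given (Pr n) (F n) (@o n)) ->
         cvg_in_distribution Pr (fun n w => x n w (o n w)) Q xstar).
Proof.
split; first by move=> n w; exact: least_equilibrium_ex.
split; first by move=> n w; exact: greatest_equilibrium_ex.
have mstar := measurable_limit_root measL.
exists (mfun_Sub (mem_set mstar)).
split; first by apply: aeW => w; exact: limit_root_cvg.
split; first exact: upper_iterate_cvg.
move=> x mx eqx.
have average (phi : R -> R) : bounded_fun phi -> lipschitz phi ->
    cvg_in_prob Pr (fun n w => n.+1%:R^-1 * \sum_(i < n.+1) phi (x n w i))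
      (\int[Q]_w phi (limit_root L w)).
  exact: (equilibrium_average_cvg randG measL lawL B1 B3 mx eqx).
split=> [phi bphi lphi|F o _ Fmeas _ Fx o_unif].
  have [K _ phiK] := lipschitz_bound lphi.
  have bstar := bounded_measurable_comp (lipschitz_bound_continuous phiK)
    (proj1 (bounded_funP phi) bphi) mstar.
  by rewrite (expectationE Q bstar); exact: average.
apply: cvg_in_distribution_lipschitz => // [n|phi bphi lphi].
  by apply: (measurable_uniform_value (y := fun i w => x n w i)) (o_unif n);
    [exact: Fmeas|exact: Fx].
have [K _ phiK] := lipschitz_bound lphi.
have cphi := lipschitz_bound_continuous phiK.
have [M phiM] := proj1 (bounded_funP phi) bphi.
rewrite (_ : (fun n => _) = fun n =>
    \int[Pr n]_w (n.+1%:R^-1 * \sum_(i < n.+1) phi (x n w i))).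
  apply: (@cvg_in_prob_expectation _ _ _ _ _ _ M); last exact: average.
    move=> n; apply: measurableT_comp => //; apply: measurable_rsum => i.
    by apply: measurableT_comp; [exact: continuous_measurable_fun|exact: mx].
  move=> n w; rewrite normrM ger0_norm ?invr_ge0// mulrC ler_pdivrMr//.
  apply: le_trans (ler_norm_sum _ _ _) _.
  apply: le_trans (ler_sum _ (fun i _ => phiM (x n w i))) _.
  by rewrite sumr_const card_ord mulr_natr.
apply/funext => n; apply: (integral_uniform_vertex (Fmeas n) (Fx n) (o_unif n)) => //.
by exists M.
Qed.
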